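(* Fix a prime $p$ and suppose that the following conjecture holds: for every cubic surface in $\mathbb{P}^3$ over $\mathbb{Q}_p$ that is tropically smooth, the $27$ lines on it have distinct tropicalizations, and in particular the $27$ lines in $\mathbb{P}^3$, their $135$ intersection points, and the $6$ points in $\mathbb{P}^2$ obtained by blowing down six skew lines are all defined over $\mathbb{Q}_p$. Fix any tropically smooth cubic surface in $\mathbb{P}^3$, given by a cubic form in $x,y,z,w$ with full support whose $20$ coefficients $c_0,\dots,c_{19}$ are $p$-adic numbers. Then there exist six points in $\mathbb{P}^2$ and a basis for the space of ternary cubics through these points, both defined over the rational numbers $\mathbb{Q}$, such that the resulting classical cubic surface in $\mathbb{P}^3$ has the same ($p$-adic) tropicalization as the given cubic.
   Context: A cubic form with full support is one in which all $20$ monomials of degree $3$ in $x,y,z,w$ occur. It is tropically smooth if the regular subdivision of its Newton polytope (three times the standard tetrahedron, with its $20$ lattice points) induced by the $p$-adic valuations of the coefficients (lifting each exponent vector to the valuation of its coefficient and projecting lower faces) is a unimodular triangulation. The tropicalization of a cubic surface is the tropical surface defined by the tropical polynomial whose coefficients are the valuations of the coefficients of the cubic; in particular, two cubics have the same tropicalization if the valuations of their coefficients coincide. The tropicalization of a line is the image (closure) of its points over an algebraic closure of $\mathbb{Q}_p$ under coordinatewise valuation. Given six points in $\mathbb{P}^2$ and a basis $(g_0,g_1,g_2,g_3)$ of the four-dimensional space of ternary cubics through them, the resulting cubic surface is the closure of the image of the rational map $(g_0:g_1:g_2:g_3):\mathbb{P}^2\dashrightarrow\mathbb{P}^3$ (the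 blow-up of $\mathbb{P}^2$ at the six points). *)

(* Defs.v *)
From mathcomp Require Import all_boot all_order all_algebra all_field.
From mathcomp Require Import all_classical all_reals ereal topology normedtype.
(* The notations of mpoly clash with those of MathComp-Analysis. *)
From mathcomp Require Import -(notations) mpoly.

Set Implicit Arguments.
Unset Strict Implicit.
Unset Printing Implicit Defensive.

Import Order.TTheory GRing.Theory Num.Theory.
Import numFieldNormedType.Exports.

Local Open Scope classical_set_scope.
Local Open Scope ring_scope.

(** Valued fields; valuations are real valued, with [v 0 = +oo]. *)

Record is_valuation (R : realType) (K : fieldType) (v : K -> \bar R) : Prop := {
  valuation_nnoo : forall x, v x <> -oo%E;
  valuation_eqoo : forall x, v x = +oo%E <-> x = 0;
  valuationM : forall x y, v (x * y) = (v x + v y)%E;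
  valuationD : forall x y, (Order.min (v x) (v y) <= v (x + y)%R)%E }.

Definition padic_val (R : realType) (p : nat) (q : rat) : \bar R :=
  if q == 0 then +oo%E
  else ((logn p `|numq q|)%:R - (logn p `|denq q|)%:R)%:E.

(* [K], with the valuation [v], is the field Q_p, that is, a completion of Q
   for the p-adic valuation.  Such a completion is unique up to a unique
   isomorphism. *)
Record is_padic_field (R : realType) (p : nat) (K : fieldType)
    (v : K -> \bar R) : Prop := {
  padic_valuation : is_valuation v;
  padic_ratr : forall q : rat, v (ratr q) = padic_val R p q;
  padic_dense : forall (x : K) (N : nat),
    exists q : rat, (N%:R%:E <= v (x - ratr q)%R)%E;
  padic_complete : forall u : nat -> K,
    (forall N : nat, exists n0 : nat, forall m n : nat,
      (n0 <= m)%N -> (n0 <= n)%N -> (N%:R%:E <= v (u m - u n)%R)%E) ->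
    exists l : K, forall N : nat, exists n0 : nat, forall n : nat,
      (n0 <= n)%N -> (N%:R%:E <= v (u n - l)%R)%E }.

Record is_valued_closure (R : realType) (K : fieldType) (v : K -> \bar R)
    (L : closedFieldType) (iota : {rmorphism K -> L}) (w : L -> \bar R)
    : Prop := {
  closure_algebraic : forall z : L, algebraicOver iota z;
  closure_valuation : is_valuation w;
  closure_extends : forall x : K, w (iota x) = v x }.

(** Forms.  Points of P^(n-1) are represented by nonzero vectors in 'rV_n,
    up to scaling; linear subspaces of P^(n-1) by vector subspaces of 'rV_n. *)

Definition is_form (K : fieldType) (n d : nat) (f : mpoly n K) : Prop :=
  f \is ishomog1 d mdeg.

Definition ev (K : fieldType) (n : nat) (f : mpoly n K) (x : 'rV[K]_n) : K :=
  meval (fun i => x 0 i) f.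

Definition full_support (K : fieldType) (f : mpoly 4 K) : Prop :=
  forall a : multinom 4, mdeg a = 3 -> mcoeff a f <> 0.

Definition zero_locus (K : fieldType) (n : nat) (f : mpoly n K)
  : set 'rV[K]_n := [set x | x != 0 /\ ev f x = 0].

Definition zariski_closure (K : fieldType) (n : nat) (S : set 'rV[K]_n)
  : set 'rV[K]_n :=
  [set x | x != 0 /\ forall (d : nat) (h : mpoly n K), is_form d h ->
     (forall y, S y -> ev h y = 0) -> ev h x = 0].

(** Tropicalization, with the min convention. *)

Definition coef_val (R : realType) (K : fieldType) (v : K -> \bar R)
  (f : mpoly 4 K) : multinom 4 -> \bar R := fun a => v (mcoeff a f).

Section CubicTropical.
Variable R : realType.
Implicit Types (h : multinom 4 -> \bar R) (u : 'rV[R]_4).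

Definition trop_term h u (a : multinom 4) : \bar R :=
  (h a + (\sum_(i < 4) u 0 i *+ a i)%:E)%E.

(* The lattice points a of the lower face of the lifted points (a, h a) on
   which the linear functional (u, 1) is minimal. *)
Definition cell h u : set (multinom 4) :=
  [set a | mdeg a = 3 /\
     forall b : multinom 4, mdeg b = 3 -> (trop_term h u a <= trop_term h u b)%E].

(* Subset of R^4 invariant under translation by multiples of (1, 1, 1, 1),
   standing for its image in the tropical projective torus. *)
Definition trop_surface h : set 'rV[R]_4 :=
  [set u | exists a b, [/\ cell h u a, cell h u b & a <> b]].

Definition regular_subdivision h : set (set (multinom 4)) :=
  [set S | exists u, S = cell h u].

Definition maximal_cells h : set (set (multinom 4)) :=
  [set S | regular_subdivision h S /\
     forall S', regular_subdivision h S' -> S `<=` S' -> S' = S].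

End CubicTropical.

(* Since the coordinates of the exponents add up to 3, the last one may be
   dropped: the points of degree 3 of Z^4 are then those of Z^3. *)
Definition edge_mx (s : 'I_4 -> multinom 4) : 'M[int]_3 :=
  \matrix_(i, j) ((s (lift ord0 i) (lift ord_max j))%:Z
                  - (s ord0 (lift ord_max j))%:Z).

Definition unimodular_simplex (S : set (multinom 4)) : Prop :=
  exists s : 'I_4 -> multinom 4, S = range s /\ `|\det (edge_mx s)| = 1.

Definition tropically_smooth (R : realType) (K : fieldType) (v : K -> \bar R)
  (f : mpoly 4 K) : Prop :=
  forall S, maximal_cells (coef_val v f) S -> unimodular_simplex S.

(* Closure of the image of the points of the line lying in the torus; like
   [trop_surface], a translation-invariant subset of R^4. *)
Definition trop_line (R : realType) (L : fieldType) (w : L -> \bar R)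
  (l : {vspace 'rV[L]_4}) : set 'rV[R]_4 :=
  closure [set (\row_i fine (w (x 0 i)) : 'rV[R]_4) | x in
    [set x : 'rV[L]_4 | x \in l /\ forall i, x 0 i != 0]].

(** Lines on a surface and blow-ups of six points. *)

Definition lines_on (L : fieldType) (f : mpoly 4 L)
  : set {vspace 'rV[L]_4} :=
  [set l | \dim l = 2%N /\ forall x, x \in l -> ev f x = 0].

Definition intersection_points (L : fieldType) (f : mpoly 4 L)
  : set {vspace 'rV[L]_4} :=
  [set q | \dim q = 1%N /\ exists l m,
     [/\ lines_on f l, lines_on f m, l <> m & q = (l :&: m)%VS]].

Definition defined_over (K L : fieldType) (iota : K -> L) (n : nat)
  (U : {vspace 'rV[L]_n}) : Prop :=
  exists B : seq 'rV[K]_n, U = <<map (map_mx iota) B>>%VS.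

Definition six_skew_lines_on (L : fieldType) (f : mpoly 4 L)
  (E : 'I_6 -> {vspace 'rV[L]_4}) : Prop :=
  (forall i, lines_on f (E i)) /\
  (forall i j, i != j -> (E i :&: E j = 0)%VS).

Definition six_points (K : fieldType) (P : 'I_6 -> 'rV[K]_3) : Prop :=
  (forall i, P i != 0) /\ (forall i j, <[P i]>%VS = <[P j]>%VS -> i = j).

Definition cubic_through (K : fieldType) (P : 'I_6 -> 'rV[K]_3)
  (h : mpoly 3 K) : Prop := is_form 3 h /\ forall i, ev h (P i) = 0.

Definition cubic_basis (K : fieldType) (P : 'I_6 -> 'rV[K]_3)
  (g : 'I_4 -> mpoly 3 K) : Prop :=
  (forall c : 'I_4 -> K, \sum_j c j *: g j = 0 -> forall j, c j = 0) /\
  (forall h, cubic_through P h <-> exists c : 'I_4 -> K, h = \sum_j c j *: g j).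

(* The closure of the image of (g_0 : g_1 : g_2 : g_3) : P^2 --> P^3. *)
Definition resulting_surface (K : fieldType) (g : 'I_4 -> mpoly 3 K)
  : set 'rV[K]_4 :=
  zariski_closure [set x | x != 0 /\
    exists q : 'rV[K]_3, x = \row_j ev (g j) q].

(* As the g_j vanish at q, the point of the exceptional curve over q that
   corresponds to the tangent direction t is sum_k t_k (d_k g_j (q))_j. *)
Definition exceptional_line (K : fieldType) (g : 'I_4 -> mpoly 3 K)
  (q : 'rV[K]_3) : {vspace 'rV[K]_4} :=
  <<[seq (\row_j ev (mderiv k (g j)) q : 'rV[K]_4) | k : 'I_3]>>%VS.

(* The surface f = 0 is the blow-up of P^2 at the points P_i, and the lines
   E_i are blown down to them. *)
Definition blow_down (K : fieldType) (f : mpoly 4 K)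
  (E : 'I_6 -> {vspace 'rV[K]_4}) (P : 'I_6 -> 'rV[K]_3) : Prop :=
  six_points P /\
  exists g : 'I_4 -> mpoly 3 K,
    [/\ cubic_basis P g, zero_locus f = resulting_surface g
      & forall i, E i = exceptional_line g (P i)].

(** The conjecture on tropically smooth cubic surfaces over K = Q_p, with L an
    algebraic closure of K. *)

Definition lines_conjecture (R : realType) (K : fieldType) (v : K -> \bar R)
  (L : closedFieldType) (iota : {rmorphism K -> L}) (w : L -> \bar R) : Prop :=
  forall f : mpoly 4 K, is_form 3 f -> full_support f -> tropically_smooth v f ->
  let fL := map_mpoly iota f in
  [/\ (lines_on fL #= `I_27)%card /\ set_inj (lines_on fL) (trop_line w),
      forall l, lines_on fL l -> defined_over iota l,
      forall q, intersection_points fL q -> defined_over iota q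
    & (exists E, six_skew_lines_on fL E) /\
      forall E, six_skew_lines_on fL E ->
        exists P : 'I_6 -> 'rV[K]_3, blow_down fL E (fun i => map_mx iota (P i))].

(* Main.v *)
Require Import Defs.
From HB Require Import structures.
From mathcomp Require Import all_boot all_order all_algebra all_field.
From mathcomp Require Import all_classical all_reals ereal topology normedtype.
From mathcomp Require Import -(notations) mpoly.
From mathcomp Require Import ring.

Set Implicit Arguments.
Unset Strict Implicit.
Unset Printing Implicit Defensive.

Import Order.TTheory GRing.Theory Num.Theory.
Local Open Scope ring_scope.

(** A cubic surface that is the blow-up of six points with coordinates in Q_p
    can be moved, by a small change of these points and of the basis of the
    cubics, to one whose data are rational, and a small change of nonzero
    p-adic numbers does not change their valuations.  The work lies in showing
    that the equation of the surface depends continuously on the points and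
    on the basis, and that the data given by the conjecture are defined over
    Q_p, not only over its algebraic closure L.

    Continuity comes from a closed formula.  Choose coordinates in which the
    six points are (a_l : b_l : 1).  If no conic passes through them, that is,
    if their 6 x 6 matrix [veronese] of quadratic monomials is invertible,
    there is exactly one cubic through them of the form
    h_j = x^(3-j) y^j + z * (quadratic form) for each j <= 3; these form a
    basis, with coefficients rational in a and b.  For i <= 2 the form
    y h_i - x h_(i+1) vanishes on z = 0, hence equals
    z (C_i0 h_0 + ... + C_i3 h_3), where the C_ij are linear in the
    coefficients of the h_j.  These three linear syzygies are the rows of a
    3 x 4 matrix M(q) of linear forms, whose maximal minors are the h_j
    ([hcub_minor]).  Rewriting M(q) X as N(X) q, the image of h satisfies the
    cubic equation det N(X) = 0, and conversely a zero of det N has some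
    nonzero q with M(q) X = 0.  Then either X is proportional to h(q), by
    Cramer's rule, or q is one of the six points, and then X is a tangent
    vector of h at q, hence a limit of points of the image.  So det N is an
    equation of the surface over any field of characteristic zero
    ([surface_eq]).

    For the descent, let g be the basis over L given by the conjecture, and
    let E_i be the six skew exceptional lines.  Since two of these lines do
    not meet, no conic contains the six points ([no_conic]), and since they
    are skew no three points are collinear ([chord_indep]).  So there is a
    basis h over Q_p, and g = h A with A in GL_4(L).  The image of the line
    P_i P_j is a line of the surface that meets E_i in the point
    dg_(P_i)(P_j); by hypothesis such intersection points are rational.  The
    points dh_(P_i)(P_j) are rational too, so A maps many rational points to
    rational points, among them a projective frame, and A is a multiple of a
    matrix B over Q_p ([A_rational]).

    Finally det N composed with A^-1 and the given form f have the same
    zeros over L.  As the surface contains only 27 lines, some transversal of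
    E_0, E_1 and E_2 is not contained in it and meets it in three distinct
    points; this forces a cubic form with these zeros to be a multiple of f
    ([cubic_unique]).  So the closed formula, taken at (a, b, B), gives a
    multiple of f, and at rational approximations of (a, b, B) it gives a
    form over Q whose coefficients have the same valuations up to a common
    constant. *)

(** * Forms and their directional derivatives *)

Notation var i := (mpolyX _ (mnm1 i)).

Section Forms.
Variables (K : fieldType) (n : nat).
Implicit Types (h : mpoly n K) (x q t : 'rV[K]_n).

Lemma ev_scale d h (l : K) x : is_form d h -> ev h (l *: x) = l ^+ d * ev h x.
Proof.
move=> hh; rewrite /ev !mevalE mulr_sumr.
apply: eq_big_seq => m mh; rewrite mulrCA; congr (_ * _).
have <- : mdeg m = d by apply: (dhomog_mf hh).
rewrite mdegE -prodrXr -big_split /=.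
by apply: eq_bigr => i _; rewrite !mxE exprMn.
Qed.

Lemma ev0_form d h : is_form d.+1 h -> ev h 0 = 0.
Proof. by move=> hh; rewrite -(scale0r 0) (ev_scale _ _ hh) expr0n mul0r. Qed.

Lemma mnm_split (m : multinom n) d : mdeg m = d.+1 ->
  exists i m', m = mnm_add (mnm1 i) m' /\ mdeg m' = d.
Proof.
move=> md; have /existsP [i mi] : [exists i, m i != 0%N].
  rewrite -negb_forall; apply/negP => /forallP m0.
  have : mdeg m == 0%N.
    by rewrite mdeg_eq0; apply/eqP/mnmP => i; rewrite mnm0E; apply/eqP.
  by rewrite md.
exists i, (mnm_sub m (mnm1 i)).
have e : m = mnm_add (mnm1 i) (mnm_sub m (mnm1 i)).
  apply/mnmP => j; rewrite mnmDE mnmBE mnm1E.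
  by case: eqP => [<-|_]; rewrite ?subnKC ?lt0n // subn0.
by split=> //; move: md; rewrite {1}e mdegD mdeg1 => -[].
Qed.

(** Cubic forms are spanned by products of three variables; identities that
    are linear in the form only need to be checked on these. *)
Lemma cubic_form_ind (P : mpoly n K -> Prop) :
  P 0 -> (forall f g, P f -> P g -> P (f + g)) ->
  (forall c f, P f -> P (c *: f)) ->
  (forall i j k, P (var i * var j * var k)) ->
  forall h, is_form 3 h -> P h.
Proof.
move=> P0 PD PZ PX h hh; rewrite (mpolyE h).
rewrite big_seq_cond; apply: big_ind => // m /andP [mh _].
have md : mdeg m = 3 by apply: (dhomog_mf hh).
apply: PZ; have [i [m1 [-> m1d]]] := mnm_split md.
have [j [m2 [-> m2d]]] := mnm_split m1d.
have /mdeg1P [k /eqP ->] : mdeg m2 == 1 by rewrite m2d.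
by rewrite !mpolyXD mulrA.
Qed.

(** The derivative of h at q in the direction t, kept as a scalar so that
    statements about tangent vectors are equations in the field. *)
Definition dderiv h q t : K := \sum_k t 0 k * ev (mderiv k h) q.

Lemma evD f g x : ev (f + g) x = ev f x + ev g x.
Proof. exact: mevalD. Qed.
Lemma evB f g x : ev (f - g) x = ev f x - ev g x.
Proof. exact: mevalB. Qed.
Lemma evM f g x : ev (f * g) x = ev f x * ev g x.
Proof. exact: mevalM. Qed.
Lemma evZ c f x : ev (c *: f) x = c * ev f x.
Proof. exact: mevalZ. Qed.
Lemma evX i x : ev (var i) x = x 0 i.
Proof. exact: mevalXU. Qed.
Lemma ev_sum (I : finType) (F : I -> mpoly n K) x :
  ev (\sum_i F i) x = \sum_i ev (F i) x.
Proof. by rewrite /ev raddf_sum. Qed.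

Lemma dderivD f g q t : dderiv (f + g) q t = dderiv f q t + dderiv g q t.
Proof.
rewrite /dderiv -big_split /=; apply: eq_bigr => k _.
by rewrite mderivD evD mulrDr.
Qed.

Lemma dderivZ c f q t : dderiv (c *: f) q t = c * dderiv f q t.
Proof.
rewrite /dderiv mulr_sumr; apply: eq_bigr => k _.
by rewrite mderivZ evZ mulrCA.
Qed.

Lemma dderivB f g q t : dderiv (f - g) q t = dderiv f q t - dderiv g q t.
Proof. by rewrite -scaleN1r dderivD dderivZ mulN1r. Qed.

Lemma dderivM f g q t : dderiv (f * g) q t =
  dderiv f q t * ev g q + ev f q * dderiv g q t.
Proof.
rewrite /dderiv mulr_suml mulr_sumr -big_split /=; apply: eq_bigr => k _.
by rewrite mderivM evD !evM; ring.
Qed.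

Lemma dderivX i q t : dderiv (var i) q t = t 0 i.
Proof.
rewrite /dderiv (bigD1 i) //= mderivX mnm1E eqxx big1 => [|k ki].
  have -> : mnm_sub (mnm1 i) (mnm1 i) = mnm0.
    by apply/mnmP => j; rewrite mnmBE subnn mnm0E.
  by rewrite addr0 scale1r /ev mpolyX0 meval1 mulr1.
by rewrite mderivX mnm1E eq_sym (negbTE ki) scale0r /ev meval0 mulr0.
Qed.

Lemma dderiv_sum (I : finType) (F : I -> mpoly n K) q t :
  dderiv (\sum_i F i) q t = \sum_i dderiv (F i) q t.
Proof.
have dd0 : dderiv 0 q t = 0 by rewrite -(scale0r 0) dderivZ mul0r.
by apply: (big_morph (fun f => dderiv f q t)) => // f g; rewrite dderivD.
Qed.

Lemma dderiv_linear h q c t t' :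
  dderiv h q (c *: t + t') = c * dderiv h q t + dderiv h q t'.
Proof.
rewrite /dderiv mulr_sumr -big_split /=; apply: eq_bigr => k _.
by rewrite !mxE; ring.
Qed.

(** The binary cubic obtained by restricting a cubic form to the line through
    q and t. All Taylor expansions below are instances of it. *)
Lemma ev_polar h (a b : K) q t : is_form 3 h ->
  ev h (a *: q + b *: t) =
  a ^+ 3 * ev h q + a ^+ 2 * b * dderiv h q t + a * b ^+ 2 * dderiv h t q
  + b ^+ 3 * ev h t.
Proof.
move: h; apply: cubic_form_ind.
- have dd0 x y : dderiv 0 x y = 0 by rewrite -(scale0r 0) dderivZ mul0r.
  by rewrite !dd0 /ev !meval0; ring.
- by move=> f g Hf Hg; rewrite !evD Hf Hg !dderivD; ring.
- by move=> c f Hf; rewrite !evZ Hf !dderivZ; ring.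
- by move=> i j k; rewrite !dderivM !evM !evX !dderivX !mxE; ring.
Qed.

End Forms.

Section Vanishing.
Variable K : fieldType.
Hypothesis char0 : [pchar K] =i pred0.

Lemma natrK_inj : injective (fun n : nat => n%:R : K).
Proof.
suff H m n : (m <= n)%N -> m%:R = n%:R :> K -> m = n.
  move=> m n e; have [mn|/ltnW nm] := leqP m n; first exact: H.
  by apply/esym/H.
move=> mn e; apply/eqP; rewrite eqn_leq mn -subn_eq0 -((pcharf0P K).1 char0).
by rewrite natrB // e subrr eqxx.
Qed.

Lemma poly0_nat (p : {poly K}) : (forall n : nat, p.[n.+1%:R] = 0) -> p = 0.
Proof.
move=> pn; apply: (@roots_geq_poly_eq0 _ _ (mkseq (fun n => n.+1%:R) (size p))).
- by apply/allP => _ /mapP [n _ ->]; apply/rootP.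
- rewrite map_inj_uniq ?iota_uniq // => m n e.
  by have /eq_add_S := natrK_inj e.
- by rewrite size_mkseq.
Qed.

Lemma muni_coef n (p : mpoly n.+1 K) (m : multinom n.+1) :
  mcoeff (Multinom [tuple m (widen_ord (leqnSn n) i) | i < n])
    (muni p)`_(m ord_max) = mcoeff m p.
Proof.
rewrite muniE coef_sum {3}(mpolyE p) !raddf_sum /=; apply: eq_bigr => m' _.
rewrite coefZ coefXn mulr_natr mcoeffMn !mcoeffZ !mcoeffX -mulrnAr; congr (_ * _).
case: (eqVneq m' m) => [->|ne]; first by rewrite !eqxx.
case: (eqVneq (m ord_max) (m' ord_max)) => e; last by rewrite mulr0n.
rewrite mulr1n; case: eqP => // e'; case/eqP: ne.
apply/mnmP => i; case: (unliftP ord_max i) => [j ->|->]; last by rewrite e.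
move/mnmP/(_ j): e'; rewrite !mnmE.
suff -> : widen_ord (leqnSn n) j = lift ord_max j by [].
by apply: val_inj; rewrite /= /bump leqNgt ltn_ord.
Qed.

(** Induction on the number of variables: for fixed values of the others, the
    polynomial in the last variable has infinitely many roots. *)
Lemma mpoly_ev0 n (p : mpoly n K) : (forall x, ev p x = 0) -> p = 0.
Proof.
elim: n p => [|n IHn] p p0.
  apply/mpolyP => m; rewrite mcoeff0; have := p0 0.
  rewrite (mpolyE p) /ev !raddf_sum /= => {}p0; rewrite -[RHS]p0.
  apply: eq_bigr => m' _; rewrite mevalZ mevalX big_ord0 mcoeffZ mcoeffX.
  by have -> : m' = m; [apply/mnmP => -[] | rewrite eqxx].
pose ext (y : 'rV[K]_n) (s : K) : 'rV[K]_n.+1 :=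
  \row_i oapp (fun j => y 0 j) s (unlift ord_max i).
have evE y s : ev p (ext y s) =
    (map_poly (meval (fun i => y 0 i)) (muni p)).[s].
  rewrite muniE raddf_sum horner_sum /ev mevalE; apply: eq_bigr => m _ /=.
  rewrite map_polyZ /= hornerZ map_polyXn hornerXn mevalZ mevalX -mulrA.

  congr (_ * _); rewrite big_ord_recr /= mxE unlift_none /=; congr (_ * _).
  apply: eq_bigr => i _; rewrite mnmE mxE.
  suff -> : widen_ord (leqnSn n) i = lift ord_max i by rewrite liftK.
  by apply: val_inj; rewrite /= /bump leqNgt ltn_ord.
apply/mpolyP => m; rewrite -muni_coef mcoeff0.
suff -> : (muni p)`_(m ord_max) = 0 by rewrite mcoeff0.
apply: IHn => y; have := coef_map (meval (fun i => y 0 i)) (muni p) (m ord_max).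
rewrite (_ : map_poly _ _ = 0) ?coef0 //; apply: poly0_nat => k.
by rewrite -evE.
Qed.

End Vanishing.

(** * Cubics from their coefficients: syzygies and minors *)

Section Formulas.
Variable A : comNzRingType.
Implicit Types (x y z : A) (c : nat -> nat -> A) (d s u : nat -> A).

Definition conic d x y z :=
  d 0%N * x ^+ 2 + d 1%N * (x * y) + d 2%N * y ^+ 2 + d 3%N * (x * z) + d 4%N * (y * z)
  + d 5%N * z ^+ 2.

Definition bcubic s x y :=
  s 0%N * x ^+ 3 + s 1%N * (x ^+ 2 * y) + s 2%N * (x * y ^+ 2) + s 3%N * y ^+ 3.

Definition mon3 x y j :=
  match j with 0 => x ^+ 3 | 1 => x ^+ 2 * y | 2 => x * y ^+ 2 | _ => y ^+ 3 end.

Definition hcub c x y z j := mon3 x y j + z * conic (c j) x y z.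

(** The coefficients C_ij, read off from y h_i - x h_(i+1) on the line z = 0. *)
Definition syz c i j :=
  match j with
  | 0 => - c i.+1 0%N | 1 => c i 0%N - c i.+1 1%N
  | 2 => c i 1%N - c i.+1 2%N | _ => c i 2%N
  end.

Definition syzdot c i u :=
  syz c i 0 * u 0%N + syz c i 1 * u 1%N + syz c i 2 * u 2%N + syz c i 3 * u 3%N.

(** What remains of the i-th syzygy: the coefficients of a quadratic form, to
    be shown to vanish at the six points. *)
Definition resid c i m :=
  match m with
  | 0 => - c i.+1 3%N | 1 => c i 3%N - c i.+1 4%N | 2 => c i 4%N
  | 3 => - c i.+1 5%N | 4 => c i 5%N | _ => 0 end - syzdot c i (c^~ m).

Lemma syzygy_resid c x y z i : (i < 3)%N ->
  y * hcub c x y z i - x * hcub c x y z i.+1 - z * syzdot c i (hcub c x y z) =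
  z ^+ 2 * conic (resid c i) x y z.
Proof.
case: i => [|[|[|//]]] _;
rewrite /hcub /resid /syzdot /conic /syz /mon3 /=; ring.
Qed.

(** The i-th row of the matrix M(x, y, z) of linear forms whose product with
    h is the i-th syzygy. *)
Definition syzrow c x y z i j :=
  (if j == i then y else 0) - (if j == i.+1 then x else 0) - z * syz c i j.

Definition det3 (M : nat -> nat -> A) p q r :=
  M 0%N p * (M 1%N q * M 2%N r - M 1%N r * M 2%N q)
  - M 0%N q * (M 1%N p * M 2%N r - M 1%N r * M 2%N p)
  + M 0%N r * (M 1%N p * M 2%N q - M 1%N q * M 2%N p).

(** Signed so that at z = 0 the minors are x^3, x^2 y, x y^2, y^3. *)
Definition minor M j :=
  match j with
  | 0 => - det3 M 1 2 3 | 1 => det3 M 0 2 3 | 2 => - det3 M 0 1 3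
  | _ => det3 M 0 1 2 end.

(** The twelve coefficients of the c_j that involve no z are free; the
    vanishing of [resid] expresses the remaining ones through them, and the
    identity becomes one of polynomials in these twelve unknowns. *)
Lemma hcub_minor c x y z j :
  (forall i m, (i < 3)%N -> (m < 6)%N -> resid c i m = 0) -> (j < 4)%N ->
  hcub c x y z j = minor (syzrow c x y z) j.
Proof.
move=> E jlt.
(* The residues give c_(i+1)3, c_i4, c_(i+1)5, and the three coefficients that
   these families miss: c_05, c_03 and c_34. *)
have E0 i (ilt : (i < 3)%N) : c i.+1 3%N = - syzdot c i (c^~ 0%N).
  by have /eqP := E i 0 ilt isT; rewrite /resid subr_eq0 eqr_oppLR => /eqP.
have E2 i (ilt : (i < 3)%N) : c i 4%N = syzdot c i (c^~ 2%N).
  by have /eqP := E i 2 ilt isT; rewrite /resid subr_eq0 => /eqP.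
have E3 i (ilt : (i < 3)%N) : c i.+1 5%N = - syzdot c i (c^~ 3%N).
  by have /eqP := E i 3 ilt isT; rewrite /resid subr_eq0 eqr_oppLR => /eqP.
have E4 : c 0%N 5%N = syzdot c 0 (c^~ 4%N).
  by have /eqP := E 0 4 isT isT; rewrite /resid subr_eq0 => /eqP.
have E1a : c 0%N 3%N = c 1%N 4%N + syzdot c 0 (c^~ 1%N).
  have /eqP := E 0 1 isT isT; rewrite /resid subr_eq0 subr_eq => /eqP ->.
  by rewrite addrC.
have E1b : c 3%N 4%N = c 2%N 3%N - syzdot c 2 (c^~ 1%N).
  have /eqP := E 2 1 isT isT; rewrite /resid subr_eq0 => /eqP <-.
  by rewrite opprB addrC subrK.
move: (E0 0%N isT) (E0 1%N isT) (E0 2%N isT) (E2 0%N isT) (E2 1%N isT) (E2 2%N isT)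
      (E3 0%N isT) (E3 1%N isT) (E3 2%N isT) E4 E1a E1b.
rewrite /syzdot /syz {E E0 E2 E3}.
move=> e13 e23 e33 e04 e14 e24 e15 e25 e35 e05 e03 e34.
rewrite -[LHS]/(mon3 x y j + z * conic (c j) x y z).
case: j jlt => [|[|[|[|//]]]] _ ;
rewrite /hcub /minor /det3 /syzrow /= /conic /syz /mon3 /=;
rewrite ?(e15, e25, e35, e05) ?(e03, e34) ?(e04, e14, e24) ?(e13, e23, e33);
rewrite ?(e04, e14, e24) ?(e13, e23, e33); ring.
Qed.

(** Cramer's rule: [D] expands the determinant formed by M u = 0 and the two
    columns r and s of M other than p and q. *)
Lemma minor_cramer (M : nat -> nat -> A) u p q : (p < 4)%N -> (q < 4)%N ->
  (forall i, (i < 3)%N ->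
    M i 0%N * u 0%N + M i 1%N * u 1%N + M i 2%N * u 2%N + M i 3%N * u 3%N = 0) ->
  minor M p * u q = minor M q * u p.
Proof.
move=> plt qlt E.
pose Mu i := M i 0%N * u 0%N + M i 1%N * u 1%N + M i 2%N * u 2%N + M i 3%N * u 3%N.
have D e (r s : nat) : e * (Mu 0%N * (M 1%N r * M 2%N s - M 1%N s * M 2%N r)
    - Mu 1%N * (M 0%N r * M 2%N s - M 0%N s * M 2%N r)
    + Mu 2%N * (M 0%N r * M 1%N s - M 0%N s * M 1%N r)) = 0.
  by rewrite /Mu !E //; ring.
case: p plt => [|[|[|[|//]]]] _; case: q qlt => [|[|[|[|//]]]] _ //;
  rewrite /minor /det3.
- rewrite -[RHS]addr0 -(D (-1) 2 3) /Mu; ring.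
- rewrite -[RHS]addr0 -(D 1 1 3) /Mu; ring.
- rewrite -[RHS]addr0 -(D (-1) 1 2) /Mu; ring.
- rewrite -[RHS]addr0 -(D 1 2 3) /Mu; ring.
- rewrite -[RHS]addr0 -(D (-1) 0 3) /Mu; ring.
- rewrite -[RHS]addr0 -(D 1 0 2) /Mu; ring.
- rewrite -[RHS]addr0 -(D (-1) 1 3) /Mu; ring.
- rewrite -[RHS]addr0 -(D 1 0 3) /Mu; ring.
- rewrite -[RHS]addr0 -(D (-1) 0 1) /Mu; ring.
- rewrite -[RHS]addr0 -(D 1 1 2) /Mu; ring.
- rewrite -[RHS]addr0 -(D (-1) 0 2) /Mu; ring.
- rewrite -[RHS]addr0 -(D 1 0 1) /Mu; ring.
Qed.

(** Near a matrix of rank at most one the maximal minors vanish to order two,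
    so they have no derivative there. *)
Lemma minor_rank1 (M M' : nat -> nat -> A) (v w : nat -> A) e p : (p < 4)%N ->
  (forall i j, (i < 3)%N -> (j < 4)%N -> M i j = v i * w j) ->
  minor (fun i j => M i j + e * M' i j) p =
  e ^+ 2 * (minor (fun i j => M i j + M' i j) p - minor M' p)
  + e ^+ 3 * minor M' p.
Proof.
by case: p => [|[|[|[|//]]]] _ E; rewrite /minor /det3 !E //; ring.
Qed.

Lemma syzrow_linear c (x y z x' y' z' e : A) i j :
  syzrow c (x + e * x') (y + e * y') (z + e * z') i j =
  syzrow c x y z i j + e * syzrow c x' y' z' i j.
Proof. by rewrite /syzrow; case: eqP => _; case: eqP => _; ring. Qed.

(** The determinant of the matrix N(u) with N(u) q = M(q) u; it is the
    combination, with coefficients C u, of the quadrics through the twisted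
    cubic. *)
Definition detF c u :=
  syzdot c 0 u * (u 2%N ^+ 2 - u 1%N * u 3%N)
  + syzdot c 1 u * (u 0%N * u 3%N - u 1%N * u 2%N)
  + syzdot c 2 u * (u 1%N ^+ 2 - u 0%N * u 2%N).

End Formulas.

Section FormulasMorphism.
Variables (A B : comNzRingType) (phi : {rmorphism A -> B}).

Lemma hcub_morph c x y z j : phi (hcub c x y z j) =
  hcub (fun j m => phi (c j m)) (phi x) (phi y) (phi z) j.
Proof.
case: j => [|[|[|j]]]; rewrite /hcub /mon3 /conic;
by rewrite ?(rmorphD, rmorphM, rmorphXn).
Qed.

Lemma detF_morph c u : phi (detF c u) =
  detF (fun j m => phi (c j m)) (fun j => phi (u j)).
Proof.
by rewrite /detF /syzdot /syz ?(rmorphD, rmorphB, rmorphM, rmorphXn, rmorphN).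
Qed.

End FormulasMorphism.

(** * The canonical cubics through six points *)

Section BigNat.
Variable V : nmodType.
Implicit Type F : nat -> V.
Lemma sum_ord3 F : \sum_(i < 3) F i = F 0%N + F 1%N + F 2%N.
Proof. by rewrite !big_ord_recr big_ord0 /= add0r. Qed.
Lemma sum_ord4 F : \sum_(i < 4) F i = F 0%N + F 1%N + F 2%N + F 3%N.
Proof. by rewrite big_ord_recr /= sum_ord3. Qed.
Lemma sum_ord6 F : \sum_(i < 6) F i = F 0%N + F 1%N + F 2%N + F 3%N + F 4%N + F 5%N.
Proof. by rewrite !big_ord_recr big_ord0 /= add0r. Qed.
End BigNat.

Definition mon2 (A : comNzRingType) (x y z : A) m :=
  match m with
  | 0 => x ^+ 2 | 1 => x * y | 2 => y ^+ 2 | 3 => x * z | 4 => y * z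
  | _ => z ^+ 2 end.

Lemma conicE (A : comNzRingType) d (x y z : A) :
  conic d x y z = \sum_(m < 6) d m * mon2 x y z m.
Proof. by rewrite (sum_ord6 (fun m => d m * mon2 x y z m)). Qed.

Section Canonical.
Variable k : fieldType.
Variables a b : 'I_6 -> k.

(** Its columns are the quadratic monomials at the points; it is invertible
    exactly when no conic passes through them. *)
Definition veronese : 'M[k]_6 := \matrix_(m, l) mon2 (a l) (b l) 1 m.
(** Row j holds the quadratic form in h_j, whose values at the points (a : b : 1)
    must be - a^(3-j) b^j. *)
Definition cmx : 'M[k]_(4, 6) :=
  - (\matrix_(j, l) mon3 (a l) (b l) j) *m invmx veronese.
Definition cc (j m : nat) : k := cmx (inord j) (inord m).
(** The conic through all the points but the l-th, with value 1 at the
    latter. *)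
Definition dualc (l : 'I_6) (m : nat) : k := invmx veronese l (inord m).

Hypothesis Vunit : veronese \in unitmx.

Lemma conic_dual l l' : conic (dualc l) (a l') (b l') 1 = (l == l')%:R.
Proof.
have /matrixP /(_ l l') := mulVmx Vunit; rewrite !mxE => <-.
rewrite conicE; apply: eq_bigr => m _.
by rewrite /dualc inord_val mxE.
Qed.

(** Interpolation: a quadratic monomial is determined by its values at the
    six points. *)
Lemma dual_conic x y z m : (m < 6)%N ->
  \sum_l conic (dualc l) x y z * mon2 (a l) (b l) 1 m = mon2 x y z m.
Proof.
move=> mlt; under eq_bigr do rewrite conicE mulr_suml.
rewrite exchange_big /= (bigD1 (Ordinal mlt)) //=.
have H (m' : 'I_6) : \sum_l dualc l m' * mon2 x y z m' * mon2 (a l) (b l) 1 m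
    = (m == m')%:R * mon2 x y z m'.
  have /matrixP /(_ (Ordinal mlt) m') := mulmxV Vunit; rewrite !mxE => <-.
  rewrite mulr_suml; apply: eq_bigr => l _.
  by rewrite /dualc inord_val mxE /=; ring.
have /= -> := H (Ordinal mlt); rewrite eqxx mul1r big1 ?addr0 // => m' ne; rewrite H.
by rewrite eq_sym; move: ne; rewrite -val_eqE /= => /negbTE ->; rewrite mul0r.
Qed.

Lemma conic_vanish d : (forall l, conic d (a l) (b l) 1 = 0) ->
  forall m, (m < 6)%N -> d m = 0.
Proof.
move=> d0 m mlt; pose r : 'rV[k]_6 := \row_m d m.
have r0 : r *m veronese = 0.
  apply/rowP => l; rewrite !mxE -[RHS](d0 l) conicE; apply: eq_bigr => i _.
  by rewrite !mxE.
have /rowP /(_ (Ordinal mlt)) : r = 0 by rewrite -(mulmxK Vunit r) r0 mul0mx.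
by rewrite !mxE.
Qed.

Lemma conic_cc l j : (j < 4)%N -> conic (cc j) (a l) (b l) 1 = - mon3 (a l) (b l) j.
Proof.
move=> jlt; have /matrixP /(_ (inord j) l) : cmx *m veronese =
   - (\matrix_(j, l) mon3 (a l) (b l) j) by rewrite /cmx mulmxKV.
rewrite [LHS]mxE mxE [in RHS]mxE inordK // => <-; rewrite conicE.
by apply: eq_bigr => m _; rewrite /cc inord_val [veronese _ _]mxE.
Qed.

Lemma hcub_point l j : (j < 4)%N -> hcub cc (a l) (b l) 1 j = 0.
Proof. by move=> jlt; rewrite /hcub conic_cc // mul1r subrr. Qed.

(** At a point all h_j vanish, hence so does the residue of each syzygy; a
    quadratic form that vanishes at the six points is zero. *)
Lemma resid_cc i m : (i < 3)%N -> (m < 6)%N -> resid cc i m = 0.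
Proof.
move=> ilt; move: m; apply: conic_vanish => l.
have := syzygy_resid cc (a l) (b l) 1 ilt; rewrite expr1n [1 * conic _ _ _ _]mul1r => <-.
rewrite /syzdot !hcub_point // ?(ltnW ilt) //; first by ring.
exact: leq_trans ilt _.
Qed.

Lemma syzygy x y z i : (i < 3)%N ->
  y * hcub cc x y z i - x * hcub cc x y z i.+1 = z * syzdot cc i (hcub cc x y z).
Proof.
move=> ilt; apply/eqP; rewrite -subr_eq0 syzygy_resid // conicE big1 ?mulr0 //.
by move=> m _; rewrite resid_cc ?mul0r.
Qed.

Lemma hcub_minor_cc x y z j : (j < 4)%N ->
  hcub cc x y z j = minor (syzrow cc x y z) j.
Proof. by move=> jlt; apply: hcub_minor => // i m; apply: resid_cc. Qed.

Lemma syzrow_dot x y z u i : (i < 3)%N ->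
  syzrow cc x y z i 0 * u 0%N + syzrow cc x y z i 1 * u 1%N +
  syzrow cc x y z i 2 * u 2%N + syzrow cc x y z i 3 * u 3%N =
  y * u i - x * u i.+1 - z * syzdot cc i u.
Proof. by case: i => [|[|[|//]]] _; rewrite /syzrow /syzdot /=; ring. Qed.

Lemma hcub_scale e x y z j :
  hcub cc (e * x) (e * y) (e * z) j = e ^+ 3 * hcub cc x y z j.
Proof. by case: j => [|[|[|j]]]; rewrite /hcub /mon3 /conic; ring. Qed.

(** The product of the l-th dual conic with a linear form through the l-th
    point is a cubic through the six points. These products separate the
    points and their tangent directions. *)
Lemma dual_times_linear l (al be : k) : exists s : nat -> k, forall x y z,
  (al * (x - a l * z) + be * (y - b l * z)) * conic (dualc l) x y z =
  s 0%N * hcub cc x y z 0 + s 1%N * hcub cc x y z 1 + s 2%N * hcub cc x y z 2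
  + s 3%N * hcub cc x y z 3.
Proof.
pose d := dualc l; pose ga := - (al * a l + be * b l).
(* The coefficients of the product at z = 0 and those of the quotient of the
   rest by z; [r] is the quadratic form left after subtracting cubics h_j. *)
pose s j := match j with
  | 0 => al * d 0%N | 1 => al * d 1%N + be * d 0%N | 2 => al * d 2%N + be * d 1%N
  | _ => be * d 2%N end.
pose e m := match m with
  | 0 => al * d 3%N + ga * d 0%N
  | 1 => al * d 4%N + be * d 3%N + ga * d 1%N
  | 2 => be * d 4%N + ga * d 2%N
  | 3 => al * d 5%N + ga * d 3%N
  | 4 => be * d 5%N + ga * d 4%N
  | _ => ga * d 5%N end.
pose r m := e m - (s 0%N * cc 0 m + s 1%N * cc 1 m + s 2%N * cc 2 m + s 3%N * cc 3 m).
have id x y z :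
    (al * (x - a l * z) + be * (y - b l * z)) * conic d x y z -
    (s 0%N * hcub cc x y z 0 + s 1%N * hcub cc x y z 1 + s 2%N * hcub cc x y z 2
    + s 3%N * hcub cc x y z 3) = z * conic r x y z.
  rewrite /hcub /conic /r /e /s /mon3 /ga /=.
  by ring.
have r0 m : (m < 6)%N -> r m = 0.
  move: m; apply: conic_vanish => l'; have := id (a l') (b l') 1.
  rewrite [1 * conic _ _ _ _]mul1r => <-; rewrite conic_dual !hcub_point //.
  by case: eqVneq => [<-|_]; rewrite ?mulr1n ?mulr0n; ring.
exists s => x y z; apply/eqP; rewrite -subr_eq0 id conicE big1 ?mulr0 //.
by move=> m _; rewrite r0 ?mul0r.
Qed.

(** If q is none of the points, choose linear forms through the points but
    not through q: the products with the dual conics show that all dual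
    conics, hence all conics, vanish at q. *)
Lemma base_locus x y : (forall j, (j < 4)%N -> hcub cc x y 1 j = 0) ->
  exists l, x = a l /\ y = b l.
Proof.
move=> h0; have [|] := boolP [exists l, (x == a l) && (y == b l)].
  by move=> /existsP [l /andP [/eqP ? /eqP ?]]; exists l.
rewrite negb_exists => /forallP P.
have Q0 l : conic (dualc l) x y 1 = 0.
  have [al [be ne]] : exists al be : k, al * (x - a l * 1) + be * (y - b l * 1) != 0.
    have := P l; rewrite negb_and => /orP [ne|ne].
      by exists 1, 0; rewrite mul0r addr0 mul1r mulr1 subr_eq0.
    by exists 0, 1; rewrite mul0r add0r mul1r mulr1 subr_eq0.
  have [s /(_ x y 1)] := dual_times_linear l al be.
  rewrite !h0 // !mulr0 !addr0 => /eqP.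
  by rewrite mulf_eq0 (negbTE ne) => /eqP.
have := dual_conic x y 1 (isT : (5 < 6)%N).
rewrite big1 => [|l _]; last by rewrite Q0 mul0r.
by rewrite /= expr1n => /eqP; rewrite eq_sym oner_eq0.
Qed.

End Canonical.

(** * Polynomials of the parametrization and of the surface *)

Section FormClosure.
Variables (K : fieldType) (n : nat).
Implicit Types f g : mpoly n K.

Lemma is_formD (d : nat) f g : is_form d f -> is_form d g -> is_form d (f + g).
Proof. exact: dhomogD. Qed.
Lemma is_formN d f : is_form d f -> is_form d (- f).
Proof. by move=> ff; rewrite /is_form -mulN1r -(mpolyCN n 1) mul_mpolyC dhomogZ. Qed.
Lemma is_formZ d c f : is_form d f -> is_form d (c *: f).
Proof. exact: dhomogZ. Qed.
Lemma is_formM d e f g : is_form d f -> is_form e g -> is_form (d + e) (f * g).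
Proof. exact: dhomogM. Qed.
Lemma is_formXn d f m : is_form d f -> is_form (d * m) (f ^+ m).
Proof. exact: dhomogMn. Qed.
Lemma is_form_var i : is_form 1 (var i : mpoly n K).
Proof. by rewrite /is_form dhomogX /= mdeg1. Qed.
Lemma is_form_sum d (I : finType) (F : I -> mpoly n K) :
  (forall i, is_form d (F i)) -> is_form d (\sum_i F i).
Proof.
move=> Fd; apply: big_ind => //; first exact: dhomog0.
by move=> f g; apply: is_formD.
Qed.

End FormClosure.

Lemma det_mx33 (R : comNzRingType) (N : nat -> nat -> R) :
  \det (\matrix_(i < 3, j < 3) N i j) = det3 N 0%N 1%N 2.
Proof.
rewrite (expand_det_row _ ord0) !big_ord_recl big_ord0 /cofactor.
rewrite !(expand_det_row _ ord0) !big_ord_recl !big_ord0 /cofactor !det_mx11.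
rewrite !mxE /= /bump /= /det3 !(addn0, add0n, add1n) /=.
ring.
Qed.

(** Coordinates indexed by natural numbers, to match the coefficient
    functions of the explicit formulas. *)
Definition crd (k : nzRingType) n (q : 'rV[k]_n.+1) (j : nat) : k := q 0 (inord j).

Lemma crdE (k : nzRingType) n (q : 'rV[k]_n.+1) j : q 0 (inord j) = crd q j.
Proof. by []. Qed.

Section DetKernel.
Variable k : fieldType.
Implicit Types (c : nat -> nat -> k) (u : nat -> k).

(** [detF] is the determinant of a 3 x 3 matrix, so it vanishes exactly when
    that matrix has a kernel. *)
Lemma detF_eq0P c u : detF c u = 0 <-> exists2 q : 'rV[k]_3, q != 0 &
  forall i, (i < 3)%N ->
    crd q 1 * u i - crd q 0 * u i.+1 - crd q 2 * syzdot c i u = 0.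
Proof.
pose N r i := match r with
  | 0 => - u i.+1 | 1 => u i | _ => - syzdot c i u end.
have -> : detF c u = \det (\matrix_(i < 3, j < 3) N i j).
  by rewrite det_mx33 /det3 /N /= /detF; ring.
have E (q : 'rV[k]_3) (i : 'I_3) : (q *m \matrix_(i < 3, j < 3) N i j) 0 i =
    crd q 1 * u i - crd q 0 * u i.+1 - crd q 2 * syzdot c i u.
  rewrite mxE; under eq_bigr => j _ do rewrite mxE -[j in q 0 j]inord_val.
  by rewrite (sum_ord3 (fun j => crd q j * N j i)) /N /=; ring.
split=> [/eqP /det0P [q q0 qN]|[q q0 qN]].
  exists q => // i ilt; have := E q (Ordinal ilt); rewrite qN mxE /= => <-.
  by [].
apply/eqP/det0P; exists q => //; apply/rowP => i; rewrite E mxE.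
exact: qN.
Qed.

End DetKernel.

Definition pt3 (R : nzRingType) (x y z : R) : 'rV[R]_3 :=
  \row_(i < 3) match (i : nat) with 0 => x | 1 => y | _ => z end.

Lemma crd_pt3 (R : nzRingType) (x y z : R) : let q := pt3 x y z in
  (crd q 0 = x) * (crd q 1 = y) * (crd q 2 = z).
Proof. by rewrite /crd !mxE !inordK. Qed.

Lemma rowP_crd (R : nzRingType) n (q q' : 'rV[R]_n.+1) :
  (forall j, (j < n.+1)%N -> crd q j = crd q' j) -> q = q'.
Proof. by move=> H; apply/rowP => j; have := H j (ltn_ord j); rewrite /crd inord_val. Qed.

Definition ccp (k : fieldType) (a b : 'I_6 -> k) n (j m : nat) : mpoly n k :=
  mpolyC n (cc a b j m).

(** The coordinates X, Y, Z of the plane are parameters: the canonical cubics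
    are also needed in coordinates in which the line z = 0 avoids given points. *)
HB.lock Definition hform (k : fieldType) (a b : 'I_6 -> k) (X Y Z : mpoly 3 k)
    (j : nat) : mpoly 3 k :=
  hcub (ccp a b 3) X Y Z j.

(** The equation det N of the surface, in the coordinates of P^3 given by the
    matrix B. *)
HB.lock Definition Fpoly (k : fieldType) (a b : 'I_6 -> k) (B : 'M[k]_4) : mpoly 4 k :=
  detF (ccp a b 4) (fun j => \sum_i invmx B i (inord j) *: var i).

Section Polys.
Variable k : fieldType.
Variables a b : 'I_6 -> k.

Local Notation hform := (hform a b).
Local Notation Fpoly := (Fpoly a b).
Local Notation ccp := (ccp a b).

Definition hpoly := hform (var (inord 0)) (var (inord 1)) (var (inord 2)).

Definition gpoly (B : 'M[k]_4) (j : 'I_4) : mpoly 3 k :=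
  \sum_(i < 4) B i j *: hpoly i.

Lemma ev_hform X Y Z j q :
  ev (hform X Y Z j) q = hcub (cc a b) (ev X q) (ev Y q) (ev Z q) j.
Proof.
rewrite /ev hform.unlock (hcub_morph (meval (fun i => q 0 i))).
by congr hcub; apply/funext => i; apply/funext => m; rewrite /= mevalC.
Qed.

Lemma ev_hpoly j q :
  ev (hpoly j) q = hcub (cc a b) (crd q 0) (crd q 1) (crd q 2) j.
Proof. by rewrite ev_hform !evX. Qed.

Lemma ev_Fpoly B x : ev (Fpoly B) x = detF (cc a b) (crd (x *m invmx B)).
Proof.
rewrite /ev Fpoly.unlock (detF_morph (meval (fun i => x 0 i))); congr detF.
  by apply/funext => i; apply/funext => m; rewrite /= mevalC.
apply/funext => j.
transitivity (ev (\sum_i invmx B i (inord j) *: var i : mpoly 4 k) x) => //.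
rewrite ev_sum /crd mxE.
by apply: eq_bigr => i _; rewrite evZ evX mulrC.
Qed.

Lemma is_form_conic (d : nat -> k) (X Y Z : mpoly 3 k) :
  is_form 1 X -> is_form 1 Y -> is_form 1 Z ->
  is_form 2 (conic (fun m => mpolyC 3 (d m)) X Y Z).
Proof.
move=> HX HY HZ; rewrite /conic !mul_mpolyC.
by do !apply: is_formD; apply: is_formZ; rewrite ?expr2; apply: (@is_formM _ _ 1 1).
Qed.

Lemma is_form_hform X Y Z j : is_form 1 X -> is_form 1 Y -> is_form 1 Z ->
  is_form 3 (hform X Y Z j).
Proof.
move=> HX HY HZ; rewrite hform.unlock; apply: is_formD.
  case: j => [|[|[|j]]] /=;
  by [exact: (@is_formXn _ _ 1)
    | apply: (@is_formM _ _ 2 1) => //; exact: (@is_formXn _ _ 1)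
    | apply: (@is_formM _ _ 1 2) => //; exact: (@is_formXn _ _ 1)].
by apply: (@is_formM _ _ 1 2) => //; apply: is_form_conic.
Qed.

Lemma is_form_hpoly j : is_form 3 (hpoly j).
Proof. by apply: is_form_hform; apply: is_form_var. Qed.

Lemma is_form_gpoly B j : is_form 3 (gpoly B j).
Proof. by apply: is_form_sum => i; apply: is_formZ; apply: is_form_hpoly. Qed.

Lemma is_form_Fpoly B : is_form 3 (Fpoly B).
Proof.
have Hy j : is_form 1 (\sum_i invmx B i (inord j) *: var i : mpoly 4 k).
  by apply: is_form_sum => i; apply: is_formZ; apply: is_form_var.
rewrite Fpoly.unlock; set y := (fun j => \sum_i _) in Hy *.
have Hs i : is_form 1 (syzdot (ccp 4) i y).
  rewrite /syzdot /syz /ccp -!(mpolyCN, mpolyCB) !mul_mpolyC.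
  by do !apply: is_formD; apply: is_formZ; apply: Hy.
have Hq i j : is_form 2 (y i * y j).
  by apply: (@is_formM _ _ 1 1); apply: Hy.
rewrite /detF !expr2; apply: is_formD; [apply: is_formD|];
  by apply: (@is_formM _ _ 1 2); [apply: Hs | apply: is_formD => //; apply: is_formN].
Qed.

End Polys.

(** * Tangent vectors at the six points *)

Definition image_pts (k : fieldType) (g : 'I_4 -> mpoly 3 k) : set 'rV[k]_4 :=
  [set x | x != 0 /\ exists q : 'rV[k]_3, x = \row_j ev (g j) q].

Section TangentClosure.
Variable k : fieldType.
Hypothesis char0 : [pchar k] =i pred0.

Lemma mmap_horner n (H : mpoly n k) (w : 'I_n -> {poly k}) e :
  (mmap polyC w H).[e] = meval (fun i => (w i).[e]) H.
Proof.
rewrite /mmap horner_sum mevalE; apply: eq_bigr => m _.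
rewrite hornerM hornerC; congr (_ * _).
by rewrite /mmap1 horner_prod; apply: eq_bigr => i _; rewrite horner_exp.
Qed.

(** The point g(P + e t) is e times a vector w(e), polynomial in e, with
    w(0) = dg_P(t). A form that vanishes at w(e) for all e <> 0
    vanishes at w(0). *)
Lemma tangent_closure (g : 'I_4 -> mpoly 3 k) P t d (H : mpoly 4 k) x0 :
  (forall j, is_form 3 (g j)) -> (forall j, ev (g j) P = 0) ->
  is_form d H -> image_pts g x0 -> (forall y, image_pts g y -> ev H y = 0) ->
  ev H (\row_j dderiv (g j) P t) = 0.
Proof.
move=> gf gP Hf Sx0 HS.
have H0 : ev H 0 = 0 by rewrite -(scale0r x0) (ev_scale _ _ Hf) HS ?mulr0.
pose w e : 'rV[k]_4 :=
  \row_j (dderiv (g j) P t + dderiv (g j) t P * e + ev (g j) t * e ^+ 2).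
have Hw e : e != 0 -> ev H (w e) = 0.
  move=> e0; have gE : \row_j ev (g j) (P + e *: t) = e *: w e.
    apply/rowP => j; rewrite !mxE -[P]scale1r ev_polar // scale1r gP; ring.
  have [w0|wn0] := eqVneq (w e) 0; first by rewrite w0.
  have : ev H (e *: w e) = 0.
    by apply: HS; split; [rewrite scaler_eq0 negb_or e0 | exists (P + e *: t)].
  by rewrite (ev_scale _ _ Hf) => /eqP; rewrite mulf_eq0 expf_eq0 (negbTE e0) andbF => /eqP.
pose W j : {poly k} := (dderiv (g j) P t)%:P + (dderiv (g j) t P)%:P * 'X
   + (ev (g j) t)%:P * 'X ^+ 2.
have WE e : (mmap polyC W H).[e] = ev H (w e).
  rewrite mmap_horner; apply: meval_eq => i.
  by rewrite mxE /W !hornerE.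
(* The value at e = 0 is recovered from the positive integers. *)
have r0 : mmap polyC W H = 0.
  apply: (poly0_nat char0) => n; rewrite WE Hw //.
  by rewrite ((pcharf0P k).1 char0).
have := WE 0; rewrite r0 horner0 => ->; congr (ev H _).
by apply/rowP => j; rewrite !mxE; ring.
Qed.

End TangentClosure.

Lemma rank_le1 (k : fieldType) m n (M : 'M[k]_(m, n)) : (\rank M <= 1)%N ->
  exists U W, forall i j, M i j = U i * W j.
Proof.
move: (col_base M) (row_base M) (mulmx_base M).
move: (\rank M) => [|[|//]] C R <- _.
  by exists (fun=> 0), (fun=> 0) => i j; rewrite mxE big_ord0 mul0r.
by exists (C^~ ord0), (R ord0) => i j; rewrite mxE big_ord1.
Qed.

Section Surface.
Variable k : fieldType.
Hypothesis char0 : [pchar k] =i pred0.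
Variables a b : 'I_6 -> k.
Hypothesis Vunit : veronese a b \in unitmx.

Local Notation X := (var (inord 0) : mpoly 3 k).
Local Notation Y := (var (inord 1) : mpoly 3 k).
Local Notation Z := (var (inord 2) : mpoly 3 k).
Local Notation h := (hpoly a b).
Local Notation c := (cc a b).

Definition affpt l := pt3 (a l) (b l) 1.

Lemma ev_hpoly_affpt l j : (j < 4)%N -> ev (h j) (affpt l) = 0.
Proof. by move=> jlt; rewrite ev_hpoly !crd_pt3 hcub_point. Qed.

Lemma hpoly_syzygy i : (i < 3)%N -> Y * h i - X * h i.+1 =
  Z * (syz c i 0 *: h 0 + syz c i 1 *: h 1 + syz c i 2 *: h 2 + syz c i 3 *: h 3).
Proof.
move=> ilt; apply/eqP; rewrite -subr_eq0; apply/eqP.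
apply: (mpoly_ev0 char0) => q; rewrite !(evB, evD, evZ, evM, evX, ev_hpoly, crdE).
by rewrite syzygy // /syzdot; ring.
Qed.

Definition tanvec l t : 'rV[k]_4 := \row_j dderiv (h j) (affpt l) t.

Lemma crd_tanvec l t j : (j < 4)%N -> crd (tanvec l t) j = dderiv (h j) (affpt l) t.
Proof. by move=> jlt; rewrite /crd mxE inordK. Qed.

Lemma tanvec_linear l e t t' : tanvec l (e *: t + t') = e *: tanvec l t + tanvec l t'.
Proof. by apply/rowP => j; rewrite !mxE dderiv_linear. Qed.

(** Derivative at the l-th point of the cubic of [dual_times_linear]: the
    tangent vectors at that point in the directions (1, 0, 0) and (0, 1, 0)
    are independent. *)
Lemma dual_tangent l (al be : k) : exists s : 'cV[k]_4, forall t,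
  (tanvec l t *m s) 0 0 =
    al * (crd t 0 - a l * crd t 2) + be * (crd t 1 - b l * crd t 2).
Proof.
have [s sE] := dual_times_linear Vunit l al be; exists (\col_j s j) => t.
pose L := al *: X + be *: Y + (- (al * a l + be * b l)) *: Z.
have [Q evQ] : exists Q : mpoly 3 k, forall q,
    ev Q q = conic (dualc a b l) (crd q 0) (crd q 1) (crd q 2).
  exists (conic (fun m => mpolyC 3 (dualc a b l m)) X Y Z) => q.
  by rewrite /conic !(evD, evM) /ev !(mevalC, rmorphXn) /= !mevalXU.
have LQ : L * Q = s 0%N *: h 0 + s 1%N *: h 1 + s 2%N *: h 2 + s 3%N *: h 3.
  apply/eqP; rewrite -subr_eq0; apply/eqP; apply: (mpoly_ev0 char0) => q.
  rewrite !(evB, evD, evZ, evM, ev_hpoly) evQ -sE /L !(evD, evZ, evX, crdE); ring.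
have /(congr1 (fun p => dderiv p (affpt l) t)) := LQ.
rewrite dderivM !(dderivD, dderivZ, evD, evZ, evX, dderivX, crdE) evQ !crd_pt3.
rewrite conic_dual // eqxx mulr1n => E.
rewrite mxE; under eq_bigr => j _ do rewrite mxE mxE.
rewrite (sum_ord4 (fun j => dderiv (h j) (affpt l) t * s j)).
transitivity (s 0%N * dderiv (h 0) (affpt l) t + s 1%N * dderiv (h 1) (affpt l) t
  + s 2%N * dderiv (h 2) (affpt l) t + s 3%N * dderiv (h 3) (affpt l) t); first by ring.
by rewrite -E; ring.
Qed.

Lemma tanvec_syzygy l t i : (i < 3)%N ->
  b l * crd (tanvec l t) i - a l * crd (tanvec l t) i.+1
    - syzdot c i (crd (tanvec l t)) = 0.
Proof.
move=> ilt; have /(congr1 (fun p => dderiv p (affpt l) t)) := hpoly_syzygy ilt.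
have ilt4 : (i < 4)%N by apply: leq_trans ilt _.
rewrite dderivB !dderivM !(dderivD, dderivZ, evD, evZ) !ev_hpoly_affpt // !evX.
rewrite !crdE !crd_pt3 -!crd_tanvec // => E.
rewrite /syzdot; apply/eqP; rewrite subr_eq0; apply/eqP.
move: E; rewrite !(mulr0, add0r, addr0, mul1r) => ->.
by [].
Qed.


Definition syzmx l : 'M[k]_(3, 4) := \matrix_(i, j) syzrow c (a l) (b l) 1 i j.

(** If the rank were at most one, the minors h_j would have no derivative at
    the point, contrary to [dual_tangent]. *)
Lemma rank_syzmx l : (1 < \rank (syzmx l))%N.
Proof.
rewrite ltnNge; apply/negP => /rank_le1 [v [w M1]].
have M1' i j : (i < 3)%N -> (j < 4)%N ->
    syzrow c (a l) (b l) 1 i j = v (inord i) * w (inord j).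
  by move=> ilt jlt; rewrite -M1 mxE !inordK.
suff tan0 t : tanvec l t = 0.
  have [s /(_ (pt3 1 0 0))] := dual_tangent l 1 0.
  rewrite tan0 mul0mx mxE !crd_pt3 !(mulr0, subr0, mul1r, mul0r, addr0) => /eqP.
  by rewrite eq_sym oner_eq0.
apply: rowP_crd => j jlt; rewrite crd_tanvec // [RHS]mxE.
(* On the line through the point in the direction t, the h_j are minors of
   M + e M' with M of rank one; comparing e = 1 and e = -1 isolates the term
   of degree one. *)
pose M' := syzrow c (crd t 0) (crd t 1) (crd t 2).
pose N := minor (fun i j => syzrow c (a l) (b l) 1 i j + M' i j) j - minor M' j.
have E e : e * dderiv (h j) (affpt l) t + e ^+ 2 * dderiv (h j) t (affpt l) = e ^+ 2 * N.
  have := ev_polar 1 e (affpt l) t (is_form_hpoly a b j).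
  rewrite ev_hpoly_affpt // [ev _ t]ev_hpoly [ev _ (_ + _)]ev_hpoly.
  rewrite !hcub_minor_cc // -/M'.
  have crdD i : crd (1 *: affpt l + e *: t) i = crd (affpt l) i + e * crd t i.
    by rewrite /crd !mxE mul1r.
  rewrite !crdD !crd_pt3.
  have -> : syzrow c (a l + e * crd t 0) (b l + e * crd t 1) (1 + e * crd t 2) =
      fun i j => syzrow c (a l) (b l) 1 i j + e * M' i j.
    by apply/funext => i; apply/funext => m; apply: syzrow_linear.
  rewrite (minor_rank1 M' e jlt M1') -/N => /eqP; rewrite -subr_eq0 => /eqP E.
  apply/eqP; rewrite -subr_eq0 -oppr_eq0 -[X in _ == X]E; apply/eqP; ring.
have E1 := E 1; have E2 := E (-1).
have : 2%:R * dderiv (h j) (affpt l) t = 0.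
  transitivity ((1 * dderiv (h j) (affpt l) t + 1 ^+ 2 * dderiv (h j) t (affpt l)) -
    (-1 * dderiv (h j) (affpt l) t + (-1) ^+ 2 * dderiv (h j) t (affpt l))); first by ring.
  by rewrite E1 E2; ring.
by move/eqP; rewrite mulf_eq0 ((pcharf0P k).1 char0) => /eqP.
Qed.

(** The kernel of M at a point has dimension at most two and contains two
    independent tangent vectors. *)
Lemma ker_tangent l (u : 'rV[k]_4) :
  (forall i, (i < 3)%N ->
    b l * crd u i - a l * crd u i.+1 - syzdot c i (crd u) = 0) ->
  exists t, u = tanvec l t.
Proof.
have inK (u' : 'rV[k]_4) : (forall i, (i < 3)%N ->
    b l * crd u' i - a l * crd u' i.+1 - syzdot c i (crd u') = 0) ->
    (u' <= kermx (syzmx l)^T)%MS.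
  move=> u'E; apply/sub_kermxP/rowP => i; rewrite !mxE.
  under eq_bigr => j _ do rewrite !mxE -[j in u' 0 j]inord_val.
  rewrite (sum_ord4 (fun j => crd u' j * syzrow c (a l) (b l) 1 i j)).
  have := syzrow_dot a b (a l) (b l) 1 (crd u') (ltn_ord i).
  rewrite mul1r u'E // => <-; ring.
move=> uE.
pose e (i : 'I_2) : 'rV[k]_3 := if i == 0 then pt3 1 0 0 else pt3 0 1 0.
pose T : 'M[k]_(2, 4) := \matrix_(i, j) tanvec l (e i) 0 j.
have Tfree : row_free T.
  have [s1 s1E] := dual_tangent l 1 0; have [s2 s2E] := dual_tangent l 0 1.
  apply/row_freeP; exists (\matrix_(m, j) (if j == 0 then s1 else s2) m 0).
  apply/matrixP => i j.
  transitivity ((tanvec l (e i) *m (if j == 0 then s1 else s2)) 0 0).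
    by rewrite [LHS]mxE [RHS]mxE; apply: eq_bigr => m _; rewrite !mxE.
  rewrite [RHS]mxE /e -!val_eqE.
  case: i => [[|[|//]] ilt]; case: j => [[|[|//]] jlt] /=;
    rewrite ?s1E ?s2E !crd_pt3 ?mulr1n ?mulr0n; ring.
have eqK : (T == kermx (syzmx l)^T)%MS.
  have sTK : (T <= kermx (syzmx l)^T)%MS.
    apply/row_subP => i; have -> : row i T = tanvec l (e i).
      by apply/rowP => j; rewrite !mxE.
    by apply: inK => j jlt; apply: tanvec_syzygy.
  rewrite sTK /= -(geq_leqif (mxrank_leqif_sup sTK)) (eqP Tfree).
  rewrite mxrank_ker mxrank_tr leq_subLR.
  by have := rank_syzmx l; rewrite -(leq_add2r 2).
have /submxP [d ->] : (u <= T)%MS by rewrite (eqmxP eqK) inK.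
exists (d 0 ord0 *: e ord0 + d 0 (lift ord0 ord0) *: e (lift ord0 ord0)).
have tanZ z t : tanvec l (z *: t) = z *: tanvec l t.
  have tan0 : tanvec l 0 = 0.
    have := tanvec_linear l 1 0 0; rewrite !scale1r addr0 => /eqP.
    by rewrite -subr_eq0 opprD addNKr oppr_eq0 => /eqP.
  by rewrite -[z *: t]addr0 tanvec_linear tan0 addr0.
rewrite tanvec_linear tanZ; apply/rowP => j.
by rewrite !mxE !big_ord_recl big_ord0 !mxE addr0.
Qed.

Lemma hpoly_image_crd q : \row_(j < 4) ev (h j) q =
  \row_(j < 4) hcub c (crd q 0) (crd q 1) (crd q 2) j.
Proof. by apply/rowP => j; rewrite !mxE ev_hpoly. Qed.

Lemma ev_gpoly B q : \row_j ev (gpoly a b B j) q = (\row_(j < 4) ev (h j) q) *m B.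
Proof.
apply/rowP => j; rewrite !mxE ev_sum; apply: eq_bigr => i _.
by rewrite evZ mxE mulrC.
Qed.

Lemma dderiv_gpoly B q t :
  \row_j dderiv (gpoly a b B j) q t = (\row_(j < 4) dderiv (h j) q t) *m B.
Proof.
apply/rowP => j; rewrite !mxE dderiv_sum; apply: eq_bigr => i _.
by rewrite dderivZ mxE mulrC.
Qed.

Lemma crd_row n (F : nat -> k) j : (j < n.+1)%N -> crd (\row_(i < n.+1) F i) j = F j.
Proof. by move=> jlt; rewrite /crd mxE inordK. Qed.

(** The point X with M(q) X = 0 is h(q) up to a scalar if h(q) is not zero,
    and a tangent vector otherwise. *)
Lemma hpoly_dependent q u : q != 0 ->
  (forall i, (i < 3)%N ->
    crd q 1 * crd u i - crd q 0 * crd u i.+1 - crd q 2 * syzdot c i (crd u) = 0) ->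
  (exists e, u = e *: \row_(j < 4) ev (h j) q) \/ (exists l t, u = tanvec l t).
Proof.
move=> q0 E.
pose H j := hcub c (crd q 0) (crd q 1) (crd q 2) j.
have cramer i j : (i < 4)%N -> (j < 4)%N -> H i * crd u j = H j * crd u i.
  move=> ilt jlt; rewrite /H !hcub_minor_cc //; apply: minor_cramer => //.
  by move=> m mlt; rewrite syzrow_dot // E.
have [/existsP [i Hi]|] := boolP [exists i : 'I_4, H i != 0].
  left; exists (crd u i / H i); apply: rowP_crd => j jlt.
  rewrite hpoly_image_crd /crd !mxE inordK // -/(H j) crdE.
  by rewrite mulrAC -[crd u i * _]mulrC -cramer // mulrAC mulfV // mul1r.
rewrite negb_exists => /forallP H0.
have {}H0 j : (j < 4)%N -> H j = 0.
  by move=> jlt; have := H0 (Ordinal jlt); rewrite negbK => /eqP.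
right; have z0 : crd q 2 != 0.
  apply: contraNneq q0 => z0; apply/eqP/rowP_crd => j jlt; rewrite [RHS]mxE.
  have := H0 0%N isT; have := H0 3%N isT.
  rewrite /H /hcub z0 !mul0r !addr0 /= => /eqP; rewrite expf_eq0 /= => /eqP y0.
  move=> /eqP; rewrite expf_eq0 /= => /eqP x0.
  by case: j jlt => [|[|[|//]]].
have [l [xl yl]] : exists l, crd q 0 / crd q 2 = a l /\ crd q 1 / crd q 2 = b l.
  apply: (base_locus Vunit) => j jlt; have := H0 j jlt; rewrite /H => Hj.
  have := hcub_scale a b (crd q 2) (crd q 0 / crd q 2) (crd q 1 / crd q 2) 1 j.
  rewrite mulr1 ![crd q 2 * (_ / _)]mulrC !divfK // Hj => /esym/eqP.
  by rewrite mulf_eq0 expf_eq0 (negbTE z0) /= => /eqP.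
exists l; apply: ker_tangent => i ilt; rewrite -xl -yl.
apply: (mulfI z0); rewrite mulr0 -[RHS](E i ilt); field.
exact: z0.
Qed.

End Surface.

(** * The equation of the image *)

Section CubicDecomposition.
Variable k : fieldType.

Lemma ord3_case (i : 'I_3) : i = inord 0 \/ i = inord 1 \/ i = inord 2.
Proof.
case: i => [[|[|[|//]]] ilt]; [left|right; left|right; right];
by apply: val_inj; rewrite /= inordK.
Qed.

Lemma quadric_decomp (i j : 'I_3) : exists d : nat -> k, forall q : 'rV[k]_3,
  q 0 i * q 0 j = conic d (crd q 0) (crd q 1) (crd q 2).
Proof.
pose D (e m : nat) : k := (m == e)%:R.
have H e : (e < 6)%N -> exists d : nat -> k, forall x y z, mon2 x y z e = conic d x y z.
  move=> elt; exists (D e) => x y z.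
  by case: e elt => [|[|[|[|[|[|//]]]]]] _; rewrite /conic /D /=; ring.
have [d0 E0] := H 0%N isT; have [d1 E1] := H 1%N isT; have [d2 E2] := H 2%N isT.
have [d3 E3] := H 3%N isT; have [d4 E4] := H 4%N isT; have [d5 E5] := H 5%N isT.
case: (ord3_case i) => [->|[->|->]]; case: (ord3_case j) => [->|[->|->]];
  [exists d0|exists d1|exists d3|exists d1|exists d2|exists d4|exists d3|exists d4|exists d5]
  => q; rewrite -?E0 -?E1 -?E2 -?E3 -?E4 -?E5 /mon2 !crdE; ring.
Qed.

(** A product of two variables is one of the monomials [mon2]; multiplying a
    quadratic form by a third variable separates the terms divisible by z. *)
Lemma cubic_decomp (f : mpoly 3 k) : is_form 3 f ->
  exists s d : nat -> k, forall q, ev f q =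
    bcubic s (crd q 0) (crd q 1) + crd q 2 * conic d (crd q 0) (crd q 1) (crd q 2).
Proof.
move: f; apply: cubic_form_ind.
- exists (fun=> 0), (fun=> 0) => q; rewrite /ev meval0 /bcubic /conic; ring.
- move=> f g [s [d E]] [s' [d' E']].
  exists (fun j => s j + s' j), (fun j => d j + d' j) => q.
  by rewrite evD E E' /bcubic /conic; ring.
- move=> e f [s [d E]]; exists (fun j => e * s j), (fun j => e * d j) => q.
  by rewrite evZ E /bcubic /conic; ring.
move=> i j m; have [d E] := quadric_decomp i j.
case: (ord3_case m) => [->|[->|->]].
- exists (fun m => match m with 3 => 0 | _ => d m end),
    (fun m => match m with 0 => d 3%N | 1 => d 4%N | 3 => d 5%N | _ => 0 end) => q.
  by rewrite !evM !evX E crdE /bcubic /conic; ring.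
- exists (fun m => match m with 0 => 0 | m'.+1 => d m' end),
    (fun m => match m with 1 => d 3%N | 2 => d 4%N | 4 => d 5%N | _ => 0 end) => q.
  by rewrite !evM !evX E crdE /bcubic /conic; ring.
- exists (fun=> 0), d => q.
  by rewrite !evM !evX E crdE /bcubic /conic; ring.
Qed.

End CubicDecomposition.

Section SurfaceEq.
Variable k : fieldType.
Hypothesis char0 : [pchar k] =i pred0.
Variables a b : 'I_6 -> k.
Hypothesis Vunit : veronese a b \in unitmx.
Variable B : 'M[k]_4.
Hypothesis Bunit : B \in unitmx.

Local Notation h := (hpoly a b).
Local Notation c := (cc a b).

Lemma hrow_axis x y : \row_(j < 4) ev (h j) (pt3 x y 0) = \row_(j < 4) mon3 x y j.
Proof.
by apply/rowP => j; rewrite !mxE ev_hpoly !crd_pt3 /hcub mul0r addr0.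
Qed.

(** Subtracting the combination of the h_j with the same restriction to z = 0
    leaves z times a quadratic form that vanishes at the six points. *)
Lemma hcub_span f : is_form 3 f -> (forall l, ev f (affpt a b l) = 0) ->
  exists s : nat -> k, f = \sum_(j < 4) s j *: h j.
Proof.
move=> ff f0; have [s [d E]] := cubic_decomp ff; exists s.
pose r m := d m - (s 0%N * c 0 m + s 1%N * c 1 m + s 2%N * c 2 m + s 3%N * c 3 m).
have id q : ev f q - ev (\sum_(j < 4) s j *: h j) q =
    crd q 2 * conic r (crd q 0) (crd q 1) (crd q 2).
  rewrite E ev_sum; under eq_bigr do rewrite evZ ev_hpoly.
  rewrite (sum_ord4 (fun j => s j * hcub c (crd q 0) (crd q 1) (crd q 2) j)).
  by rewrite /hcub /bcubic /conic /r /mon3 /=; ring.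
have r0 m : (m < 6)%N -> r m = 0.
  move: m; apply: (conic_vanish Vunit) => l; have := id (affpt a b l).
  rewrite f0 ev_sum big1 => [|j _]; last by rewrite evZ ev_hpoly_affpt ?mulr0.
  by rewrite !crd_pt3 mul1r subr0.
apply/eqP; rewrite -subr_eq0; apply/eqP; apply: (mpoly_ev0 char0) => q.
by rewrite evB id conicE big1 ?mulr0 // => m _; rewrite r0 ?mul0r.
Qed.

(** The dual conics distinguish the points. *)
Lemma six_points_affpt : six_points (affpt a b).
Proof.
split=> [l|l l' e].
  by apply: contra_neq (oner_neq0 k) => e; have := crd_pt3 (a l) (b l) 1;
    rewrite -/(affpt a b l) e /crd !mxE => -[_ <-].
have : affpt a b l \in <[affpt a b l']>%VS by rewrite -e memv_line.
move=> /vlineP [z E].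
have H j := congr1 (fun q : 'rV_3 => crd q j) E.
have crdZ j q : crd (z *: q : 'rV[k]_3) j = z * crd q j by rewrite /crd !mxE.
have := H 2%N; rewrite /= crdZ !crd_pt3 mulr1 => z1.
have := H 0%N; rewrite /= crdZ !crd_pt3 -z1 mul1r => ea.
have := H 1%N; rewrite /= crdZ !crd_pt3 -z1 mul1r => eb.
have := conic_dual Vunit l l'; rewrite -ea -eb conic_dual // eqxx.
by case: eqVneq => // _ /eqP; rewrite oner_eq0.
Qed.

Lemma cubic_basis_gpoly : cubic_basis (affpt a b) (gpoly a b B).
Proof.
have lincomb (e : 'I_4 -> k) : \sum_j e j *: gpoly a b B j =
    \sum_(i < 4) (B *m (\col_j e j)) i 0 *: h i.
  rewrite /gpoly; under eq_bigr do rewrite scaler_sumr.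
  rewrite exchange_big /=; apply: eq_bigr => i _; rewrite mxE scaler_suml.
  by apply: eq_bigr => j _; rewrite scalerA mxE mulrC.
split=> [e e0 j|f].
  have {}e0 q : (\row_(i < 4) ev (h i) q) *m (B *m (\col_j e j)) = 0.
    apply/rowP => i; rewrite ord1 [RHS]mxE.
    have := congr1 (fun f => ev f q) e0; rewrite lincomb ev_sum /ev meval0 => <-.
    by rewrite mxE; apply: eq_bigr => m _; rewrite mevalZ mxE mulrC.
  suff w0 : B *m (\col_j e j) = 0.
    have /colP /(_ j) : \col_j e j = 0 by rewrite -(mulKmx Bunit (\col_j e j)) w0 mulmx0.
    by rewrite !mxE.
  move: (B *m _) e0 => w e0.
  have E x y : x ^+ 3 * w (inord 0) 0 + x ^+ 2 * y * w (inord 1) 0 +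
      x * y ^+ 2 * w (inord 2) 0 + y ^+ 3 * w (inord 3) 0 = 0.
    have /rowP /(_ 0) := e0 (pt3 x y 0); rewrite hrow_axis [RHS]mxE => <-.
    rewrite mxE; under eq_bigr => i _ do rewrite mxE -{2}[i]inord_val.
    by rewrite (sum_ord4 (fun i => mon3 x y i * w (inord i) 0)).
  (* On the line z = 0 the h_j are the monomials of a binary cubic, whose
     coefficients are found from the points (1, 0), (0, 1), (1, 1), (1, -1). *)
  have w0 : w (inord 0) 0 = 0 by rewrite -[RHS](E 1 0); ring.
  have w3 : w (inord 3) 0 = 0 by rewrite -[RHS](E 0 1); ring.
  have w12 : w (inord 1) 0 + w (inord 2) 0 = 0.
    by rewrite -[RHS](E 1 1) w0 w3; ring.
  have w2 : w (inord 2) 0 = 0.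
    have : 2%:R * w (inord 2) 0 = 0.
      transitivity (w (inord 1) 0 + w (inord 2) 0 + (1 ^+ 3 * w (inord 0) 0 +
        1 ^+ 2 * (-1) * w (inord 1) 0 + 1 * (-1) ^+ 2 * w (inord 2) 0 +
        (-1) ^+ 3 * w (inord 3) 0)); first by rewrite w0 w3; ring.
      by rewrite E w12 addr0.
    by move/eqP; rewrite mulf_eq0 ((pcharf0P k).1 char0) => /eqP.
  move: w12; rewrite w2 addr0 => w1.
  apply/colP => i; rewrite [RHS]mxE -[i]inord_val.
  by case: i => [[|[|[|[|//]]]] ilt].
split=> [[ff f0]|[e ->]].
  have [s ->] := hcub_span ff f0.
  exists (fun j => (invmx B *m (\col_(j < 4) s j)) j 0); rewrite lincomb.
  apply: eq_bigr => j _; congr (_ *: _).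
  have -> : \col_j (invmx B *m (\col_(j < 4) s j)) j 0 = invmx B *m (\col_(j < 4) s j).
    by apply/colP => i; rewrite mxE.
  by rewrite mulKVmx // mxE.
split=> [|l].
  by apply: is_form_sum => j; apply: is_formZ; apply: is_form_gpoly.
rewrite lincomb ev_sum big1 // => i _.
by rewrite evZ ev_hpoly_affpt ?mulr0.
Qed.

(** The zeros of [Fpoly] are points of the image or tangent vectors at one of
    the six points; both belong to the closure of the image. *)
Theorem surface_eq : zero_locus (Fpoly a b B) = resulting_surface (gpoly a b B).
Proof.
have imageE q : q != 0 ->
    detF c (crd (\row_(j < 4) ev (h j) q)) = 0.
  move=> q0; apply/detF_eq0P; exists q => // i ilt.
  have ilt4 : (i < 4)%N by apply: leq_trans ilt _.
  rewrite !(crd_row (fun j => ev (h j) q)) // !ev_hpoly syzygy //.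
  by rewrite /syzdot !(crd_row (fun j => ev (h j) q)) // !ev_hpoly subrr.
apply/seteqP; split=> x [x0 xE]; split=> //.
  move=> d H Hf HS.
  (* The image of (1 : 0 : 0) shows that the image is not empty. *)
  have Sx0 : image_pts (gpoly a b B) (\row_j ev (gpoly a b B j) (pt3 1 0 0)).
    split; last by exists (pt3 1 0 0).
    rewrite ev_gpoly hrow_axis; apply/eqP => /(congr1 (mulmx^~ (invmx B))).
    rewrite mulmxK // mul0mx => /rowP /(_ 0); rewrite !mxE /= expr1n => /eqP.
    by rewrite oner_eq0.
  pose u := x *m invmx B.
  have xu : x = u *m B by rewrite mulmxKV.
  have : detF c (crd u) = 0 by rewrite -ev_Fpoly.
  move=> /detF_eq0P [q q0 /(hpoly_dependent char0 Vunit q0) []] // [].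
    move=> e ue; have xe : x = e *: \row_j ev (gpoly a b B j) q.
      by rewrite xu ue -scalemxAl ev_gpoly.
    rewrite xe (ev_scale _ _ Hf) HS ?mulr0 //; split; last by exists q.
    by apply: contraNneq x0 => g0; rewrite xe g0 scaler0.
  move=> l [t ut].
  have -> : x = \row_j dderiv (gpoly a b B j) (affpt a b l) t by rewrite dderiv_gpoly xu ut.
  apply: (tangent_closure char0 t _ _ Hf Sx0 HS) => j; first exact: is_form_gpoly.
  have /rowP /(_ j) := ev_gpoly a b B (affpt a b l); rewrite mxE => ->.
  rewrite mxE big1 // => i _; rewrite mxE ev_hpoly_affpt ?mul0r //.
apply: (xE 3); first exact: is_form_Fpoly.
move=> y [y0 [q yE]]; rewrite ev_Fpoly yE ev_gpoly mulmxK // imageE //.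
apply: contraNneq y0 => q0; rewrite yE q0; apply/eqP/rowP => j.
by rewrite !mxE (@ev0_form _ _ 2) //; apply: is_form_gpoly.
Qed.

End SurfaceEq.

(** * Uniqueness of the equation of a cubic surface *)

(** The discriminant of a X^3 + b X^2 + c X + d. *)
Definition disc3 (A : comNzRingType) (a b c d : A) : A :=
  b ^+ 2 * c ^+ 2 - 4%:R * a * c ^+ 3 - 4%:R * b ^+ 3 * d
  - 27%:R * a ^+ 2 * d ^+ 2 + 18%:R * a * b * c * d.

Section Unique.
Variable L : closedFieldType.
Hypothesis char0 : [pchar L] =i pred0.

Lemma two_neq0 : 2%:R != 0 :> L.
Proof. by rewrite ((pcharf0P L).1 char0). Qed.

(** The values at 1 and -1 separate the terms of even and odd degree. *)
Lemma cubic_coefs (a b c d a' b' c' : L) :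
  (forall e, a * e ^+ 3 + b * e ^+ 2 + c * e + d =
    a' * e ^+ 3 + b' * e ^+ 2 + c' * e + d) ->
  a = a' -> b = b' /\ c = c'.
Proof.
move=> E ea; rewrite -ea in E; have E1 := E 1; have E2 := E (-1).
split; apply: (mulfI two_neq0).
  transitivity ((a * 1 ^+ 3 + b * 1 ^+ 2 + c * 1 + d) +
    (a * (-1) ^+ 3 + b * (-1) ^+ 2 + c * (-1) + d) - 2%:R * d); first by ring.
  by rewrite E1 E2; ring.
transitivity ((a * 1 ^+ 3 + b * 1 ^+ 2 + c * 1 + d) -
    (a * (-1) ^+ 3 + b * (-1) ^+ 2 + c * (-1) + d) - 2%:R * a); first by ring.
by rewrite E1 E2; ring.
Qed.

Lemma disc3_roots (a b c d : L) : a != 0 -> disc3 a b c d != 0 ->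
  exists r1 r2 r3, [/\ r1 != r2, r2 != r3, r3 != r1 &
    forall r, r \in [:: r1; r2; r3] -> a * r ^+ 3 + b * r ^+ 2 + c * r + d = 0].
Proof.
move=> a0 D0; pose p : {poly L} := Poly [:: d; c; b; a].
have sp : polyseq p = [:: d; c; b; a] by rewrite (@PolyK _ 0).
have [rs prs] := closed_field_poly_normal p.
have srs : size rs = 3%N.
  have : size p = 4%N by rewrite sp.
  rewrite prs size_scale ?size_prod_XsubC; first by case.
  by rewrite lead_coef_eq0 -size_poly_eq0 sp.
have lp : lead_coef p = a by rewrite lead_coefE sp.
case: rs srs prs => [|r1 [|r2 [|r3 [|//]]]] // _.
rewrite !big_cons big_nil mulr1 lp => prs.
have E e : a * e ^+ 3 + b * e ^+ 2 + c * e + d =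
    a * ((e - r1) * ((e - r2) * (e - r3))).
  transitivity p.[e]; first by rewrite horner_Poly /=; ring.
  by rewrite prs !hornerE.
have Ed : d = - a * (r1 * r2 * r3).
  by have := E 0; rewrite !expr0n /= !mulr0 !add0r => ->; ring.
have [Eb Ec] : b = - a * (r1 + r2 + r3) /\ c = a * (r1 * r2 + r2 * r3 + r3 * r1).
  by apply: (@cubic_coefs a _ _ d a) => // e; rewrite E Ed; ring.
have DE : disc3 a b c d =
    a ^+ 4 * ((r1 - r2) ^+ 2 * (r2 - r3) ^+ 2 * (r3 - r1) ^+ 2).
  by rewrite Eb Ec Ed /disc3; ring.
exists r1, r2, r3; split.
- by apply: contraNneq D0 => e; rewrite DE e subrr expr0n /= !mul0r mulr0.
- by apply: contraNneq D0 => e; rewrite DE e subrr expr0n /= mulr0 mul0r mulr0.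
- by apply: contraNneq D0 => e; rewrite DE e subrr expr0n /= !mulr0.
by move=> r; rewrite !inE E => /or3P [] /eqP ->; ring.
Qed.

Lemma quadratic_vanish (r1 r2 r3 g0 g1 g2 : L) :
  r1 != r2 -> r2 != r3 -> r3 != r1 ->
  (forall r, r \in [:: r1; r2; r3] -> g2 * r ^+ 2 + g1 * r + g0 = 0) -> g0 = 0.
Proof.
move=> n12 n23 n31 E; have E1 := E r1; have E2 := E r2; have E3 := E r3.
have /eqP : (r1 - r2) * (r2 - r3) * (r3 - r1) * g0 = 0.
  transitivity ((g2 * r1 ^+ 2 + g1 * r1 + g0) * (r2 * r3 * (r3 - r2))
    + (g2 * r2 ^+ 2 + g1 * r2 + g0) * (r1 * r3 * (r1 - r3))
    + (g2 * r3 ^+ 2 + g1 * r3 + g0) * (r1 * r2 * (r2 - r1))); first by ring.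
  by rewrite E1 ?E2 ?E3 ?inE ?eqxx ?orbT //; ring.
by rewrite !mulf_eq0 !subr_eq0 (negbTE n12) (negbTE n23) (negbTE n31) => /eqP.
Qed.

(** Let O be a point of the given line off the surface, and let G1 be the
    combination of f and G that vanishes at O. On a line through O the form
    G1 has degree at most two, and it vanishes at the zeros of f. Where the
    discriminant of f in the direction O is not zero there are three of them,
    so G1 vanishes there. The discriminant is a polynomial that is not zero
    on the given line, hence G1 = 0. *)
Lemma cubic_unique n (f G : mpoly n L) (p0 p1 : 'rV[L]_n) (de : L) :
  is_form 3 f -> is_form 3 G -> de != 0 ->
  (forall e1 e2, ev f (e1 *: p0 + e2 *: p1) = e1 * e2 * (e1 - e2) * de) ->
  (forall x, zero_locus f x -> ev G x = 0) ->
  exists ka, G = ka *: f.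
Proof.
move=> ff Gf de0 fline Gv; pose O := p0 - p1.
have fO : ev f O = - (2%:R * de).
  have := fline 1 (-1); rewrite scale1r scaleN1r => ->; ring.
have fO0 : ev f O != 0 by rewrite fO oppr_eq0 mulf_neq0 ?two_neq0.
pose bm : mpoly n L := \sum_i ev (mderiv i f) O *: var i.
pose cm : mpoly n L := \sum_i O 0 i *: mderiv i f.
have evb x : ev bm x = dderiv f O x.
  by rewrite /bm ev_sum; apply: eq_bigr => i _; rewrite evZ evX mulrC.
have evc x : ev cm x = dderiv f x O.
  by rewrite /cm ev_sum; apply: eq_bigr => i _; rewrite evZ.
pose am : mpoly n L := mpolyC n (ev f O).
have eva x : ev am x = ev f O by rewrite /ev mevalC.
pose D : mpoly n L := disc3 am bm cm f.
have evD3 x : ev D x = disc3 (ev f O) (dderiv f O x) (dderiv f x O) (ev f x).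
  rewrite -(eva x) -evb -evc /D /disc3 /ev.
  by rewrite !(rmorph_nat, rmorphB, rmorphM, rmorphXn, rmorphD).
have polar (g : mpoly n L) x e : is_form 3 g -> ev g (x + e *: O) =
    ev g O * e ^+ 3 + dderiv g O x * e ^+ 2 + dderiv g x O * e + ev g x.
  by move=> gf; rewrite -{1}[x]scale1r ev_polar //; ring.
pose G1 := ev f O *: G - ev G O *: f.
have G1f : is_form 3 G1.
  apply: dhomogD; first exact: dhomogZ.
  by rewrite -scaleNr; apply: dhomogZ.
have G1O : ev G1 O = 0 by rewrite evB !evZ; ring.
have G1v x : ev f x = 0 -> ev G1 x = 0.
  move=> fx; rewrite evB !evZ fx mulr0 subr0.
  have [->|x0] := eqVneq x 0; first by rewrite (ev0_form Gf) mulr0.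
  by rewrite Gv ?mulr0.
have DG1 : D * G1 = 0.
  apply: (mpoly_ev0 char0) => x; rewrite evM.
  have [->|Dx] := eqVneq (ev D x) 0; first by rewrite mul0r.
  rewrite evD3 in Dx; have [r1 [r2 [r3 [n12 n23 n31 rE]]]] := disc3_roots fO0 Dx.
  rewrite (_ : ev G1 x = 0) ?mulr0 //.
  apply: (@quadratic_vanish r1 r2 r3 _ (dderiv G1 x O) (dderiv G1 O x)) => // r rin.
  have := polar G1 x r G1f; rewrite G1O mul0r add0r => <-.
  by apply: G1v; rewrite polar // rE.
(* At p0 the form is a cubic in e with roots 0, -1 and -1/2. *)
have D0 : D != 0.
  apply: contraNneq (mulf_neq0 (mulf_neq0 de0 de0) (mulf_neq0 de0 de0)) => D0.
  have fp0 : ev f p0 = 0.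
    have := fline 1 0; rewrite scale1r scale0r addr0 => ->; ring.
  have [Eb Ec] : dderiv f O p0 = - (3%:R * de) /\ dderiv f p0 O = - de.
    apply: (@cubic_coefs (ev f O) _ _ 0 (ev f O)) => // e.
    have := polar f p0 e ff; rewrite fp0 => <-.
    have -> : p0 + e *: O = (1 + e) *: p0 + (- e) *: p1.
      by rewrite /O scalerBr scalerDl scale1r scaleNr addrA.
    by rewrite fline fO; ring.
  have := evD3 p0; rewrite D0 Eb Ec fO fp0 /ev meval0 /disc3 => E.
  by rewrite [X in X == _](_ : _ = 0) // E; ring.
have /eqP := DG1; rewrite mulf_eq0 (negbTE D0) /= subr_eq0 => /eqP GE.
exists (ev G O / ev f O); apply: (scalerI fO0).
by rewrite GE scalerA mulrC divfK.
Qed.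

End Unique.

(** * Change of base field *)

Section Functor.
Variables (k k' : fieldType) (phi : {rmorphism k -> k'}).

Lemma map_mpoly_inj n : injective (map_mpoly phi : mpoly n k -> mpoly n k').
Proof.
move=> p q /mpolyP e; apply/mpolyP => m; have := e m.
by rewrite !mcoeff_map_mpoly => /fmorph_inj.
Qed.

Lemma map_var n (i : 'I_n) : map_mpoly phi (var i : mpoly n k) = var i.
Proof. exact: map_mpolyX. Qed.

Lemma map_is_form n d (p : mpoly n k) :
  is_form d p -> is_form d (map_mpoly phi p).
Proof.
move=> pf; apply/dhomogP => m; rewrite mcoeff_msupp mcoeff_map_mpoly fmorph_eq0.
by rewrite -mcoeff_msupp => /(dhomog_mf pf).
Qed.

Lemma ev_map n (p : mpoly n k) q :
  ev (map_mpoly phi p) (map_mx phi q) = phi (ev p q).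
Proof.
have -> : map_mpoly phi p =
    \sum_(m <- msupp p) phi (mcoeff m p) *: mpolyX k' m.
  rewrite {1}(mpolyE p) (raddf_sum (map_mpoly phi)); apply: eq_bigr => m _.
  by rewrite /= map_mpolyZ map_mpolyX.
rewrite /ev [in RHS]mevalE !raddf_sum /=; apply: eq_bigr => m _.
rewrite mevalZ mevalX rmorphM rmorph_prod; congr (_ * _).
by apply: eq_bigr => i _; rewrite mxE rmorphXn.
Qed.

Lemma mderiv_map n (p : mpoly n k) i :
  mderiv i (map_mpoly phi p) = map_mpoly phi (mderiv i p).
Proof.
apply/mpolyP => m; rewrite mcoeff_mderiv !mcoeff_map_mpoly mcoeff_mderiv.
by rewrite raddfMn.
Qed.

Lemma dderiv_map n (p : mpoly n k) q t :
  dderiv (map_mpoly phi p) (map_mx phi q) (map_mx phi t) = phi (dderiv p q t).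
Proof.
rewrite /dderiv rmorph_sum; apply: eq_bigr => i _.
by rewrite rmorphM /= mderiv_map ev_map mxE.
Qed.

Variables a b : 'I_6 -> k.

Lemma mon2_morph x y z m : phi (mon2 x y z m) = mon2 (phi x) (phi y) (phi z) m.
Proof.
by case: m => [|[|[|[|[|m]]]]] /=; rewrite ?rmorphM ?rmorphXn.
Qed.

Lemma mon3_morph x y j : phi (mon3 x y j) = mon3 (phi x) (phi y) j.
Proof. by case: j => [|[|[|j]]] /=; rewrite ?rmorphM ?rmorphXn. Qed.

Lemma veronese_map :
  map_mx phi (veronese a b) = veronese (phi \o a) (phi \o b).
Proof. by apply/matrixP => m l; rewrite !mxE mon2_morph rmorph1. Qed.

Lemma cc_map j m : phi (cc a b j m) = cc (phi \o a) (phi \o b) j m.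
Proof.
rewrite /cc; transitivity (map_mx phi (cmx a b) (inord j) (inord m)).
  by rewrite [RHS]mxE.
congr (fun_of_matrix _ _ _); rewrite /cmx map_mxM map_invmx veronese_map map_mxN.
congr (- _ *m _); apply/matrixP => j' l; rewrite !mxE; exact: mon3_morph.
Qed.

Lemma ccp_map n : (fun j m => map_mpoly phi (ccp a b n j m)) =
  ccp (phi \o a) (phi \o b) n.
Proof.
by apply/funext => j; apply/funext => m; rewrite /ccp map_mpolyC /= cc_map.
Qed.

Lemma hform_map X Y Z j : map_mpoly phi (hform a b X Y Z j) =
  hform (phi \o a) (phi \o b) (map_mpoly phi X) (map_mpoly phi Y) (map_mpoly phi Z) j.
Proof. by rewrite !hform.unlock (hcub_morph (map_mpoly phi)) ccp_map. Qed.

Lemma hpoly_map j : map_mpoly phi (hpoly a b j) = hpoly (phi \o a) (phi \o b) j.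
Proof. by rewrite hform_map !map_var. Qed.

Lemma gpoly_map B j : map_mpoly phi (gpoly a b B j) =
  gpoly (phi \o a) (phi \o b) (map_mx phi B) j.
Proof.
rewrite /gpoly raddf_sum; apply: eq_bigr => i _.
by rewrite /= map_mpolyZ hpoly_map mxE.
Qed.

Lemma Fpoly_map B : map_mpoly phi (Fpoly a b B) =
  Fpoly (phi \o a) (phi \o b) (map_mx phi B).
Proof.
rewrite !Fpoly.unlock (detF_morph (map_mpoly phi)) ccp_map; congr detF.
apply/funext => j; rewrite raddf_sum; apply: eq_bigr => i _.
by rewrite /= map_mpolyZ map_var -map_invmx mxE.
Qed.

End Functor.

Lemma Fpoly_scale (k : fieldType) (a b : 'I_6 -> k) mu (B : 'M[k]_4) :
  [pchar k] =i pred0 -> mu != 0 -> B \in unitmx ->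
  Fpoly a b (mu *: B) = mu ^- 3 *: Fpoly a b B.
Proof.
move=> char0 mu0 Bu; apply/eqP; rewrite -subr_eq0; apply/eqP.
apply: (mpoly_ev0 char0) => x; rewrite evB evZ !ev_Fpoly.
have -> : invmx (mu *: B) = mu^-1 *: invmx B.
  by rewrite invmxZ ?unitmxZ ?unitfE.
rewrite -scalemxAr; have crdZ j : crd (mu^-1 *: (x *m invmx B)) j =
    mu^-1 * crd (x *m invmx B) j by rewrite /crd mxE.
rewrite /detF /syzdot !crdZ -exprVn; ring.
Qed.

(** * Planes, projective frames and exceptional lines *)

Section TwoDim.
Variables (k : fieldType) (V : vectType k).
Implicit Types (p q e : V) (U : {vspace V}).

Definition indep2 p q := forall al be : k, al *: p + be *: q = 0 -> al = 0 /\ be = 0.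

Lemma indep2_free p q : indep2 p q -> free [:: p; q].
Proof.
move=> H; rewrite free_cons seq1_free span_seq1; apply/andP; split.
  apply/negP => /vlineP [e E]; have [] := H 1 (- e).
    by rewrite E scale1r scaleNr subrr.
  by move/eqP; rewrite oner_eq0.
apply: contraTneq isT => q0; have [] := H 0 1.
  by rewrite q0 scale0r scaler0 addr0.
by move=> _ /eqP; rewrite oner_eq0.
Qed.

Lemma span2 U p q e : indep2 p q -> p \in U -> q \in U -> \dim U = 2 ->
  e \in U -> exists al be, e = al *: p + be *: q.
Proof.
move=> /indep2_free fpq pU qU dU eU.
have sU : (<<[:: p; q]>> <= U)%VS.
  by apply/span_subvP => x; rewrite !inE => /orP [] /eqP ->.
have spU : <<[:: p; q]>>%VS = U.
  by apply/eqP; rewrite -(geq_leqif (dimv_leqif_eq sU)) (eqP fpq) dU.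
move: eU; rewrite -spU span_cons span_seq1 => /memv_addP [_ /vlineP [al ->]].
by move=> [_ /vlineP [be ->] ->]; exists al, be.
Qed.

Lemma span2_mem p q e : e \in <<[:: p; q]>>%VS -> exists al be, e = al *: p + be *: q.
Proof.
rewrite span_cons span_seq1 => /memv_addP [_ /vlineP [al ->]].
by move=> [_ /vlineP [be ->] ->]; exists al, be.
Qed.

Lemma free_indep2 p q : free [:: p; q] -> indep2 p q.
Proof.
rewrite free_cons seq1_free span_seq1 => /andP [pq q0] al be E.
have al0 : al = 0.
  apply: contraNeq pq => al0; apply/vlineP; exists (- be / al).
  apply: (scalerI al0); rewrite scalerA mulrCA mulfV // mulr1 scaleNr.
  by apply/eqP; rewrite -subr_eq0 opprK E.
split=> //; move/eqP: E; rewrite al0 scale0r add0r scaler_eq0 (negbTE q0) orbF.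
by move/eqP.
Qed.

Lemma dim2_basis U : \dim U = 2 -> exists p q, [/\ p \in U, q \in U & indep2 p q].
Proof.
move=> dU; have ss : size (vbasis U) = 2%N by rewrite size_tuple.
have := vbasisP U; move: (tval (vbasis U)) ss => [|p [|q [|//]]] // _ bU.
exists p, q; split; [by apply: (basis_mem bU); rewrite !inE eqxx..| |].
  by apply: (basis_mem bU); rewrite !inE eqxx orbT.
exact: free_indep2 (basis_free bU).
Qed.

(** Of three pairwise independent vectors of a plane at most one is
    proportional to e, so with respect to the other two e has nonzero
    coordinates. *)
Lemma select2 U p1 p2 p3 e : \dim U = 2 ->
  [/\ p1 \in U, p2 \in U, p3 \in U & e \in U] -> e != 0 ->
  [/\ indep2 p1 p2, indep2 p1 p3 & indep2 p2 p3] ->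
  exists p q al be, [/\ (p = p1 /\ q = p2) \/ (p = p1 /\ q = p3) \/ (p = p2 /\ q = p3),
    al != 0, be != 0 & e = al *: p + be *: q].
Proof.
move=> dU [U1 U2 U3 Ue] e0 [i12 i13 i23].
have [al [be E]] := span2 i12 U1 U2 dU Ue.
have [be0|ben] := eqVneq be 0.
  have al0 : al != 0.
    by apply: contraNneq e0 => al0; rewrite E al0 be0 !scale0r addr0.
  have [al' [be' E']] := span2 i23 U2 U3 dU Ue.
  exists p2, p3, al', be'; split; [by right; right| | |exact: E'].
    apply: contraNneq al0 => z; have [] := i13 al (- be').
      rewrite scaleNr; apply/eqP; rewrite subr_eq0; apply/eqP.
      by move: E'; rewrite E be0 z !scale0r addr0 add0r.
    by move=> ->.
  apply: contraNneq al0 => z; have [] := i12 al (- al').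
    rewrite scaleNr; apply/eqP; rewrite subr_eq0; apply/eqP.
    by move: E'; rewrite E be0 z !scale0r !addr0.
  by move=> ->.
have [al0|aln] := eqVneq al 0; last by exists p1, p2, al, be; split => //; left.
have [al' [be' E']] := span2 i13 U1 U3 dU Ue.
exists p1, p3, al', be'; split; [by right; left| | |exact: E'].
  apply: contraNneq ben => z; have [] := i23 be (- be').
    rewrite scaleNr; apply/eqP; rewrite subr_eq0; apply/eqP.
    by move: E'; rewrite E al0 z !scale0r !add0r.
  by move=> ->.
apply: contraNneq ben => z; have [] := i12 (- al') be.
  rewrite addrC scaleNr; apply/eqP; rewrite subr_eq0; apply/eqP.
  by move: E'; rewrite E al0 z !scale0r addr0 add0r.
by move=> _ ->.
Qed.

End TwoDim.

(** A linear map that sends a projective frame of rational points (the rows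
    of X together with y) to rational points is rational up to a scalar. *)
Lemma frame_rational (K L : fieldType) (iota : {rmorphism K -> L}) n
    (A : 'M[L]_n) (X U : 'M[K]_n) (y u : 'rV[K]_n) (la c : 'rV[L]_n) (mu : L) :
  A \in unitmx -> X \in unitmx ->
  (forall i, row i (map_mx iota X *m A) = la 0 i *: row i (map_mx iota U)) ->
  map_mx iota y *m A = mu *: map_mx iota u ->
  map_mx iota y = c *m map_mx iota X -> (forall i, c 0 i != 0) ->
  exists B : 'M[K]_n, A = mu *: map_mx iota B.
Proof.
move=> Au Xu XA yA yX c0.
have XAE : map_mx iota X *m A = diag_mx la *m map_mx iota U.
  by apply/matrixP => i j; have /rowP /(_ j) := XA i; rewrite mul_diag_mx !mxE.
have Uu : U \in unitmx.
  rewrite -(map_unitmx iota).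
  have : map_mx iota X *m A \in unitmx by rewrite unitmx_mul map_unitmx Xu.
  by rewrite XAE unitmx_mul => /andP [].
have [cK cE] : exists cK : 'rV[K]_n, forall i, c 0 i = iota (cK 0 i).
  exists (y *m invmx X) => i; have -> : c = map_mx iota (y *m invmx X).
    by rewrite map_mxM map_invmx yX mulmxK ?map_unitmx.
  by rewrite mxE.
have [w E] : exists w : 'rV[K]_n, c *m diag_mx la = mu *: map_mx iota w.
  exists (u *m invmx U).
  apply: (can_inj (mulmxK (_ : map_mx iota U \in unitmx))); first by rewrite map_unitmx.
  rewrite -mulmxA -XAE mulmxA -yX yA -scalemxAl map_mxM map_invmx.
  by rewrite mulmxKV ?map_unitmx.
pose r := \row_i (w 0 i / cK 0 i).
have laE : la = mu *: map_mx iota r.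
  apply/rowP => i; apply: (mulfI (c0 i)).
  have /rowP /(_ i) := E; rewrite mul_mx_diag !mxE => ->.
  rewrite cE rmorphM fmorphV /= [RHS]mulrCA; congr (_ * _).
  by rewrite mulrCA mulfV ?mulr1 // -cE.
exists (invmx X *m diag_mx r *m U).
rewrite !map_mxM map_invmx map_diag_mx scalemxAl scalemxAr.
rewrite -[LHS](mulKmx (_ : map_mx iota X \in unitmx)) ?map_unitmx // XAE laE.
rewrite mulmxA; congr (_ *m _ *m _).
by apply/matrixP => i j; rewrite !mxE mulrnAr.
Qed.

Section Exceptional.
Variable k : fieldType.

Lemma exceptional_memP (g : 'I_4 -> mpoly 3 k) q w :
  w \in exceptional_line g q <-> exists t, w = \row_j dderiv (g j) q t.
Proof.
pose F i := \row_j ev (mderiv i (g j)) q : 'rV[k]_4.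
have E t : \row_j dderiv (g j) q t = \sum_i t 0 i *: F i.
  by apply/rowP => j; rewrite !mxE summxE; apply: eq_bigr => i _; rewrite !mxE.
have -> : exceptional_line g q = <<[tuple F i | i < 3]>>%VS.
  by congr span; rewrite /= val_ord_tuple.
split=> [/coord_span -> |[t ->]].
  exists (\row_i coord [tuple F i | i < 3] i w); rewrite E.
  by apply: eq_bigr => i _; rewrite !mxE -tnth_nth tnth_mktuple.
rewrite E; apply: memv_suml => i _; apply: memvZ; apply: memv_span.
by apply/tnthP; exists i; rewrite tnth_mktuple.
Qed.

End Exceptional.

(** * Descent of the parametrization *)

Section Descent.
Variables (K : fieldType) (L : closedFieldType) (iota : {rmorphism K -> L}).
Hypothesis char0 : [pchar K] =i pred0.
Variable f : mpoly 4 K.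
Hypothesis ff : is_form 3 f.
Local Notation fL := (map_mpoly iota f).
Variables (P : 'I_6 -> 'rV[K]_3) (E : 'I_6 -> {vspace 'rV[L]_4}).
Variable g : 'I_4 -> mpoly 3 L.
Local Notation PL i := (map_mx iota (P i)).
Hypothesis sixP : six_points (fun i => PL i).
Hypothesis gbasis : cubic_basis (fun i => PL i) g.
Hypothesis zl : zero_locus fL = resulting_surface g.
Hypothesis EE : forall i, E i = exceptional_line g (PL i).
Hypothesis Eline : forall i, lines_on fL (E i).
Hypothesis Eskew : forall i j, i != j -> (E i :&: E j = 0)%VS.
Hypothesis Hpts : forall q, intersection_points fL q -> defined_over iota q.
Hypothesis Hfin : (lines_on fL #= `I_27)%card.

Lemma char0L : [pchar L] =i pred0.
Proof. by move=> n; rewrite -char0 (fmorph_pchar iota). Qed.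

Lemma fLf : is_form 3 fL. Proof. exact: map_is_form. Qed.

Lemma g_through j : cubic_through (fun i => PL i) (g j).
Proof.
apply/(gbasis.2 (g j)); exists (fun i => (i == j)%:R).
rewrite (bigD1 j) //= eqxx scale1r big1 ?addr0 // => i /negbTE ->.
by rewrite scale0r.
Qed.
Let gform j : is_form 3 (g j). Proof. by case: (g_through j). Qed.
Let gP j i : ev (g j) (PL i) = 0. Proof. by case: (g_through j). Qed.

Definition param q : 'rV[L]_4 := \row_j ev (g j) q.
Definition tangent i t : 'rV[L]_4 := \row_j dderiv (g j) (PL i) t.
(** The point at which the image of the line joining P_i and P_j meets the
    exceptional line E_i. *)
Definition chord i j := tangent i (PL j).

Lemma f_param q : ev fL (param q) = 0.
Proof.
have [->|G0] := eqVneq (param q) 0; first exact: ev0_form fLf.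
have : resulting_surface g (param q).
  split=> // d h hf hS; apply: hS; split=> //; by exists q.
by rewrite -zl => -[].
Qed.

Lemma tangent_linear i e t t' :
  tangent i (e *: t + t') = e *: tangent i t + tangent i t'.
Proof. by apply/rowP => j; rewrite !mxE dderiv_linear. Qed.

Lemma tangent0 i : tangent i 0 = 0.
Proof.
have := tangent_linear i 1 0 0; rewrite !scale1r addr0 => /eqP.
by rewrite -subr_eq0 opprD addNKr oppr_eq0 => /eqP.
Qed.

Lemma tangent_comb i e e' t t' :
  tangent i (e *: t + e' *: t') = e *: tangent i t + e' *: tangent i t'.
Proof. by rewrite tangent_linear -[e' *: t']addr0 tangent_linear tangent0 addr0. Qed.

Lemma tangent_memP i w : w \in E i <-> exists t, w = tangent i t.
Proof. by rewrite EE; apply: exceptional_memP. Qed.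

Lemma tangent_mem i t : tangent i t \in E i. Proof. by apply/tangent_memP; exists t. Qed.

Lemma E_disjoint i j x : i != j -> x \in E i -> x \in E j -> x = 0.
Proof.
by move=> ij xi xj; apply/eqP; rewrite -memv0 -(Eskew ij) memv_cap xi.
Qed.

(** The image of the line joining P_i and P_j lies in the line joining the
    two chord points. *)
Lemma param_polar i j al be : param (al *: PL i + be *: PL j) =
  (al ^+ 2 * be) *: chord i j + (al * be ^+ 2) *: chord j i.
Proof.
apply/rowP => m; rewrite !mxE ev_polar // !gP; ring.
Qed.

Lemma tangent_euler i : tangent i (PL i) = 0.
Proof.
have := param_polar i i 1 1; rewrite -scalerDl.
have -> : param ((1 + 1) *: PL i) = 0.
  by apply/rowP => j; rewrite !mxE (ev_scale _ _ (gform j)) gP mulr0.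
rewrite -scalerDl => /esym/eqP; rewrite scaler_eq0 !expr1n !mulr1.
by rewrite -[1 + 1]/(2%:R) ((pcharf0P L).1 char0L) => /eqP.
Qed.

(** The image of the tangent map is the plane E_i, so its kernel is a line;
    by Euler's formula it contains P_i. *)
Lemma tangent_ker i t : tangent i t = 0 -> exists e, t = e *: PL i.
Proof.
move=> Dt; have [e1 [e2 [e1E e2E ind]]] := dim2_basis (Eline i).1.
have [t1 t1E] := (tangent_memP i e1).1 e1E; have [t2 t2E] := (tangent_memP i e2).1 e2E.
have P0 : PL i != 0 by case: sixP.
pose M : 'M[L]_3 := \matrix_(m < 3) (if m == 0 :> nat then PL i else
  if m == 1 :> nat then t1 else t2).
have comb (u : 'rV[L]_3) : u *m M = crd u 0 *: PL i + (crd u 1 *: t1 + crd u 2 *: t2).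
  rewrite mulmx_sum_row; under eq_bigr => m _ do rewrite rowK -[m in u 0 m]inord_val.
  rewrite (sum_ord3 (fun m => crd u m *: (if m == 0 then PL i else if m == 1 then t1 else t2))).
  by rewrite /= addrA.
have Dcomb u : tangent i (u *m M) = crd u 1 *: e1 + crd u 2 *: e2.
  by rewrite comb tangent_linear tangent_euler scaler0 add0r tangent_comb -t1E -t2E.
have Mu : M \in unitmx.
  rewrite -row_free_unit -kermx_eq0; apply/eqP/row_matrixP => r.
  rewrite row0; set u := row r _.
  have uM : u *m M = 0 by rewrite /u -row_mul mulmx_ker row0.
  have [u1 u2] : crd u 1 = 0 /\ crd u 2 = 0.
    by apply: ind; rewrite -Dcomb uM tangent0.
  have u0 : crd u 0 = 0.
    move: uM; rewrite comb u1 u2 !scale0r !addr0 => /eqP.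
    by rewrite scaler_eq0 (negbTE P0) orbF => /eqP.
  apply: rowP_crd => j jlt; rewrite [RHS]mxE.
  by case: j jlt => [|[|[|//]]].
exists (crd (t *m invmx M) 0); rewrite -{1}(mulmxKV Mu t) comb.
have [-> ->] : crd (t *m invmx M) 1 = 0 /\ crd (t *m invmx M) 2 = 0.
  by apply: ind; rewrite -Dcomb mulmxKV.
by rewrite !scale0r !addr0.
Qed.

Lemma PL_indep i j : i != j -> indep2 (PL i) (PL j).
Proof.
move=> ij al be e0; have Pi0 : PL i != 0 by case: sixP.
have Pj0 : PL j != 0 by case: sixP.
have al0 : al = 0.
  apply: contraNeq ij => al0; apply/eqP; apply: sixP.2.
  have Pi : PL i = (- be / al) *: PL j.
    apply: (scalerI al0); rewrite scalerA mulrCA mulfV // mulr1 scaleNr.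
    by apply/eqP; rewrite -subr_eq0 opprK e0.
  apply/eqP; rewrite eqEsubv -!memvE; apply/andP; split.
    by apply/vlineP; exists (- be / al).
  apply/vlineP; exists (al / - be); rewrite Pi scalerA.
  have be0 : - be != 0.
    by apply: contraNneq Pi0 => be0; rewrite Pi be0 mul0r scale0r.
  by rewrite mulrA divfK // mulfV // scale1r.
split=> //; move/eqP: e0; rewrite al0 scale0r add0r scaler_eq0 (negbTE Pj0) orbF.
by move/eqP.
Qed.

Arguments PL_indep {i j} _ al be _.

Lemma chord_mem i j : chord i j \in E i. Proof. exact: tangent_mem. Qed.

Lemma chord_neq0 i j : i != j -> chord i j != 0.
Proof.
move=> ij; apply/eqP => /tangent_ker [e Pj].
have [] := PL_indep ij (e) (-1); first by rewrite -Pj scaleN1r subrr.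
by move=> _ /eqP; rewrite oppr_eq0 oner_eq0.
Qed.

(** A relation between the two chord points puts P_j on the line P_i P_m. As
    the parametrization vanishes at P_j, the chord points of i and m on E_i
    and E_m would then be proportional. *)
Lemma chord_indep i j m : i != j -> i != m -> j != m -> indep2 (chord i j) (chord i m).
Proof.
move=> ij im jm al be; rewrite /chord -tangent_comb => /tangent_ker [ga E0].
have [al0|aln] := eqVneq al 0.
  split=> //; move: E0; rewrite al0 scale0r add0r => E0.
  have [] := PL_indep im ga (- be); first by rewrite -E0 scaleNr subrr.
  by move=> _ /eqP; rewrite oppr_eq0 => /eqP.
have [be0|ben] := eqVneq be 0.
  move: E0; rewrite be0 scale0r addr0 => E0.
  have [] := PL_indep ij ga (- al); first by rewrite -E0 scaleNr subrr.
  by move=> _ /eqP; rewrite oppr_eq0 (negbTE aln).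
have gan : ga != 0.
  apply/eqP => ga0; move: E0; rewrite ga0 scale0r => E0.
  by have [/eqP] := PL_indep jm _ _ E0; rewrite (negbTE aln).
have Gj : param (ga *: PL i + (- be) *: PL m) = 0.
  have -> : ga *: PL i + (- be) *: PL m = al *: PL j.
    by rewrite -E0 scaleNr addrK.
  by apply/rowP => n; rewrite !mxE (ev_scale _ _ (gform n)) gP mulr0.
have /eqP := Gj; rewrite param_polar addrC addr_eq0 => /eqP E1.
have mi : m != i by rewrite eq_sym.
have /(E_disjoint im) : (ga * (- be) ^+ 2) *: chord m i \in E i.
  by rewrite E1 -scaleNr memvZ ?chord_mem.
move=> /(_ (memvZ _ (chord_mem _ _))) /eqP.
rewrite scaler_eq0 (negbTE (chord_neq0 mi)) orbF mulf_eq0 (negbTE gan) expf_eq0 /=.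
by rewrite oppr_eq0 (negbTE ben).
Qed.

Lemma chord_line i j : i != j -> lines_on fL <<[:: chord i j; chord j i]>>%VS.
Proof.
move=> ij; have ji : j != i by rewrite eq_sym.
have ind : indep2 (chord i j) (chord j i).
  move=> al be E0; have al0 : al *: chord i j = 0.
    apply: (E_disjoint ij); first by rewrite memvZ ?chord_mem.
    move/eqP: E0; rewrite addr_eq0 => /eqP ->.
    by rewrite -scaleNr memvZ ?chord_mem.
  move/eqP: (al0); rewrite scaler_eq0 (negbTE (chord_neq0 ij)) orbF => /eqP ->.
  split=> //; move/eqP: E0; rewrite al0 add0r scaler_eq0 (negbTE (chord_neq0 ji)) orbF.
  by move/eqP.
split=> [|x /span2_mem [al [be ->]]].
  by have /eqP := indep2_free ind.
have [->|al0] := eqVneq al 0.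
  by rewrite scale0r add0r; apply: (Eline j).2; rewrite memvZ ?chord_mem.
have [->|be0] := eqVneq be 0.
  by rewrite scale0r addr0; apply: (Eline i).2; rewrite memvZ ?chord_mem.
have := f_param (al *: PL i + be *: PL j).
have -> : param (al *: PL i + be *: PL j) =
    (al * be) *: (al *: chord i j + be *: chord j i).
  by rewrite param_polar scalerDr !scalerA; congr (_ *: _ + _ *: _); ring.
rewrite (ev_scale _ _ fLf) => /eqP; rewrite mulf_eq0 expf_eq0 /=.
by rewrite mulf_eq0 (negbTE al0) (negbTE be0) /= => /eqP.
Qed.

(** The chord point is the intersection of E_i with the image of the line P_i
    P_j, which is another line of the surface. *)
Lemma chord_rational i j : i != j ->
  exists la (u : 'rV[K]_4), chord i j = la *: map_mx iota u.
Proof.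
move=> ij; have ji : j != i by rewrite eq_sym.
have cap : (E i :&: <<[:: chord i j; chord j i]>> = <[chord i j]>)%VS.
  apply/eqP; rewrite eqEsubv; apply/andP; split; last first.
    by rewrite -memvE memv_cap chord_mem memv_span ?inE ?eqxx.
  apply/subvP => x; rewrite memv_cap => /andP [xE /span2_mem [al [be xV]]].
  have be0 : be *: chord j i = 0.
    apply: (E_disjoint ji); first by rewrite memvZ ?chord_mem.
    have -> : be *: chord j i = x - al *: chord i j by rewrite xV addrAC subrr add0r.
    by rewrite memvB ?memvZ ?chord_mem.
  by rewrite xV be0 addr0 memvZ ?memv_line.
have /Hpts [B VB] : intersection_points fL <[chord i j]>%VS.
  split; first by rewrite dim_vline chord_neq0.
  exists (E i), <<[:: chord i j; chord j i]>>%VS; split; [exact: Eline|exact: chord_line| |].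
    move=> e; have := chord_neq0 ji; rewrite (@E_disjoint j i (chord j i)) ?eqxx ?chord_mem //.
    by rewrite e memv_span // !inE eqxx orbT.
  by rewrite cap.
have [/hasP [u uB u0]|] := boolP (has (fun u => u != 0) B).
  have : map_mx iota u \in <[chord i j]>%VS.
    by rewrite VB memv_span // map_f.
  move=> /vlineP [e ue]; have e0 : e != 0.
    apply: contraNneq u0 => e0; rewrite -(map_mx_eq0 iota).
    by rewrite ue e0 scale0r.
  by exists e^-1, u; rewrite ue scalerA mulVf // scale1r.
rewrite -all_predC => /allP B0.
have := chord_neq0 ij; rewrite -memv0.
have : (<[chord i j]> <= 0)%VS.
  rewrite VB; apply/span_subvP => x /mapP [u /B0 /=]; rewrite negbK => /eqP u0 ->.
  by rewrite u0 map_mx0 mem0v.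
by rewrite -memvE => ->.
Qed.

(** If Q vanished at the six points, the cubics Q X, Q Y, Q Z would be a
    three-dimensional space of linear forms on P^3 with one common zero. The
    derivative of Q l at P_i is a multiple of that of Q, so this common zero
    lies on every E_i; but E_0 and E_1 are disjoint. *)
Lemma no_conic (Q : mpoly 3 L) : is_form 2 Q -> (forall i, ev Q (PL i) = 0) -> Q = 0.
Proof.
move=> Qf QP; apply/eqP; apply/negPn/negP => Q0.
have /choice [phi phiE] (i : 'I_3) : exists c : 'I_4 -> L,
    Q * var i = \sum_j c j *: g j.
  apply/(gbasis.2 (Q * var i)); split=> [|l]; last by rewrite evM QP mul0r.
  by apply: (@is_formM _ _ 2 1) => //; apply: is_form_var.
pose M : 'M[L]_(3, 4) := \matrix_(i, j) phi i j.
have Mfree : \rank M = 3%N.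
  apply/eqP; rewrite -/(row_free M) -kermx_eq0; apply/eqP/row_matrixP => r.
  have : row r (kermx M) *m M = 0 by rewrite -row_mul mulmx_ker row0.
  rewrite row0; move: (row r (kermx M)) => u uM.
  have : Q * (\sum_i u 0 i *: var i) = 0.
    rewrite mulr_sumr; under eq_bigr do rewrite -scalerAr phiE scaler_sumr.
    rewrite exchange_big big1 //= => j _; under eq_bigr do rewrite scalerA.
    rewrite -scaler_suml; have /rowP /(_ j) := uM; rewrite [LHS]mxE [RHS]mxE.
    by under eq_bigr do rewrite [M _ _]mxE; move=> ->; rewrite scale0r.
  move/eqP; rewrite mulf_eq0 (negbTE Q0) /= => /eqP u0.
  apply/rowP => i; rewrite [RHS]mxE.
  have := congr1 (fun p => ev p (delta_mx 0 i)) u0.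
  rewrite ev_sum (bigD1 i) //= big1 => [|j ji].
    by rewrite evZ evX mxE !eqxx mulr1 addr0 /ev meval0.
  by rewrite evZ evX mxE (negbTE ji) andbF mulr0.
have kerE i : exists2 w, w \in E i & w != 0 /\ (w <= kermx M^T)%MS.
  have [e1 [e2 [/tangent_memP [t1 t1E] /tangent_memP [t2 t2E] ind]]] := dim2_basis (Eline i).1.
  (* In the plane E i there is a tangent vector along which Q does not change. *)
  have [t [tQ tD]] : exists t, dderiv Q (PL i) t = 0 /\ tangent i t != 0.
    have [n1|n1] := eqVneq (dderiv Q (PL i) t1) 0.
      exists t1; split=> //; apply/eqP => D0; have [] := ind 1 0.
        by rewrite t1E D0 scaler0 scale0r addr0.
      by move/eqP; rewrite oner_eq0.
    exists (dderiv Q (PL i) t2 *: t1 + (- dderiv Q (PL i) t1) *: t2); split.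
      have dderivZt x : dderiv Q (PL i) (x *: t2) = x * dderiv Q (PL i) t2.
        by rewrite /dderiv mulr_sumr; apply: eq_bigr => m _; rewrite mxE mulrA.
      by rewrite dderiv_linear dderivZt; ring.
    apply/eqP; rewrite tangent_comb -t1E -t2E => /ind [_ /eqP].
    by rewrite oppr_eq0 (negbTE n1).
  exists (tangent i t); first exact: tangent_mem.
  split=> //; apply/sub_kermxP/rowP => m; rewrite [RHS]mxE.
  have := congr1 (fun p => dderiv p (PL i) t) (phiE m).
  rewrite dderivM tQ QP !mul0r addr0 dderiv_sum => ->; rewrite mxE.
  by apply: eq_bigr => j _; rewrite !mxE dderivZ mulrC.
have o01 : (inord 0 : 'I_6) != inord 1 by rewrite -val_eqE /= !inordK.
have [w0 w0E [w00 w0K]] := kerE (inord 0); have [w1 w1E [w10 w1K]] := kerE (inord 1).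
have rk : \rank (kermx M^T) = 1%N by rewrite mxrank_ker mxrank_tr Mfree.
have : (w0 <= w1)%MS.
  apply: submx_trans w0K _; rewrite -(geq_leqif (mxrank_leqif_sup w1K)) rk.
  by rewrite lt0n mxrank_eq0.
move=> /sub_rVP [e we].
have : w0 \in E (inord 1) by rewrite we memvZ.
by move/(E_disjoint o01 w0E)/eqP; rewrite (negbTE w00).
Qed.

Lemma E01_full y : exists e0 e1,
  [/\ e0 \in E (inord 0), e1 \in E (inord 1) & y = e0 + e1].
Proof.
have o01 : (inord 0 : 'I_6) != inord 1 by rewrite -val_eqE /= !inordK.
have : (E (inord 0) + E (inord 1) = fullv)%VS.
  apply/eqP; rewrite eqEdim subvf /= dimvf dimv_disjoint_sum ?Eskew //.
  by rewrite !(Eline _).1.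
by move=> full; have := memvf y; rewrite -full => /memv_addP [e0 ? [e1 ? ->]]; exists e0, e1.
Qed.

(** Each point of E_2 lies on a transversal of E_0 and E_1. These
    transversals are pairwise distinct, so they are not all among the
    finitely many lines of the surface. *)
Lemma transversal : exists p0 p1 de, de != 0 /\
  forall e1 e2, ev fL (e1 *: p0 + e2 *: p1) = e1 * e2 * (e1 - e2) * de.
Proof.
pose o (m : nat) : 'I_6 := inord m.
have oE m m' : (m < 6)%N -> (m' < 6)%N -> (o m == o m') = (m == m').
  by move=> ? ?; rewrite -val_eqE /= !inordK.
have [e [e' [eE e'E ind]]] := dim2_basis (Eline (o 2)).1.
have /choice [x /choice [y xy]] (n : nat) : exists x y,
    [/\ x \in E (o 0%N), y \in E (o 1%N) & e + n%:R *: e' = x + y].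
  exact: E01_full.
have en0 n : e + n%:R *: e' != 0.
  apply/eqP => E0; have [] := ind 1 n%:R; first by rewrite scale1r.
  by move/eqP; rewrite oner_eq0.
have enE n : e + n%:R *: e' \in E (o 2) by rewrite memvD ?memvZ.
have x0 n : x n != 0.
  have [xE yE sE] := xy n; apply: contraNneq (en0 n) => z; apply/eqP.
  apply: (@E_disjoint (o 1%N) (o 2)); rewrite ?oE //.
  by rewrite sE z add0r.
have y0 n : y n != 0.
  have [xE yE sE] := xy n; apply: contraNneq (en0 n) => z; apply/eqP.
  apply: (@E_disjoint (o 0%N) (o 2)); rewrite ?oE //.
  by rewrite sE z addr0.
have xyi n : indep2 (x n) (y n).
  have [xE yE sE] := xy n; move=> al be E0.
  have ax0 : al *: x n = 0.
    have yE' : al *: x n \in E (o 1%N).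
      by move/eqP: E0; rewrite addr_eq0 => /eqP ->; rewrite memvN memvZ.
    by apply: (@E_disjoint (o 0%N) (o 1%N)) => //; rewrite ?oE ?memvZ.
  move/eqP: (ax0); rewrite scaler_eq0 (negbTE (x0 n)) orbF => /eqP ->.
  move/eqP: E0; rewrite ax0 add0r scaler_eq0 (negbTE (y0 n)) orbF => /eqP ->.
  by [].
pose T n := <<[:: x n; y n]>>%VS.
have dT n : \dim (T n) = 2 by have /eqP := indep2_free (xyi n).
have enT n : e + n%:R *: e' \in T n.
  by have [_ _ ->] := xy n; rewrite memvD // memv_span // !inE eqxx ?orbT.
have Tinj : injective T.
  move=> n m Tnm; apply: (natrK_inj char0L); apply/eqP; rewrite -subr_eq0.
  apply/negPn/negP => nm.
  have e'T : e' \in T n.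
    have : (e + n%:R *: e') - (e + m%:R *: e') \in T n.
      by rewrite memvB // Tnm.
    rewrite opprD addrACA subrr add0r -scalerBl => eT.
    have -> : e' = (n%:R - m%:R)^-1 *: ((n%:R - m%:R) *: e').
      by rewrite scalerA mulVf // scale1r.
    exact: memvZ.
  have eT : e \in T n by rewrite -(addrK (n%:R *: e') e) memvB // memvZ.
  have ET : E (o 2) = T n.
    have sub : (E (o 2) <= T n)%VS.
      apply/subvP => v /(span2 ind eE e'E (Eline (o 2)).1) [al [be ->]].
      by rewrite memvD ?memvZ.
    by apply/eqP; rewrite -(geq_leqif (dimv_leqif_eq sub)) dT (Eline _).1.
  have [xE yE sE] := xy n.
  have xT : x n \in E (o 2) by rewrite ET memv_span // inE eqxx.
  have := x0 n; rewrite (@E_disjoint (o 0%N) (o 2) (x n)) ?oE ?eqxx //.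
have [n nT] : exists n, ~ lines_on fL (T n).
  apply: contrapT => /forallNP all_lines; apply: infinite_nat.
  have fin : finite_set (lines_on fL) by exists 27%N.
  have -> : [set: nat]%classic = (T @^-1` lines_on fL)%classic.
    by apply/seteqP; split=> // n _; apply: contrapT; apply: all_lines.
  by apply: finite_preimage fin => n m _ _; apply: Tinj.
have [z zT fz] : exists2 z, z \in T n & ev fL z != 0.
  apply: contrapT => H; apply: nT; split=> // z zT.
  by apply/eqP/negPn/negP => fz; apply: H; exists z.
have [xE yE sE] := xy n.
have fx : ev fL (x n) = 0 by apply: (Eline (o 0%N)).2.
have fy : ev fL (y n) = 0 by apply: (Eline (o 1%N)).2.
have fE e1 e2 : ev fL (e1 *: x n + e2 *: y n) =
    e1 ^+ 2 * e2 * dderiv fL (x n) (y n) + e1 * e2 ^+ 2 * dderiv fL (y n) (x n).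
  by rewrite (ev_polar _ _ _ _ fLf) fx fy; ring.
(* The binary cubic vanishes at (1, 0), (0, 1) and (1, 1). *)
have f11 : dderiv fL (y n) (x n) = - dderiv fL (x n) (y n).
  have := fE 1 1; rewrite !scale1r -sE ((Eline (o 2)).2 _ (enE n)) => /esym/eqP.
  by rewrite !expr1n !mul1r addrC addr_eq0 => /eqP.
have fde e1 e2 : ev fL (e1 *: x n + e2 *: y n) =
    e1 * e2 * (e1 - e2) * dderiv fL (x n) (y n) by rewrite fE f11; ring.
exists (x n), (y n), (dderiv fL (x n) (y n)); split=> //.
have [al [be zE]] := span2_mem zT.
by apply: contraNneq fz => d0; rewrite zE fde d0 mulr0.
Qed.

Lemma f_nonzero_at : exists2 z, z != 0 & ev fL z != 0.
Proof.
have [p0 [p1 [de [de0 fde]]]] := transversal.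
have fz : ev fL (1 *: p0 + (-1) *: p1) != 0.
  have -> : ev fL (1 *: p0 + (-1) *: p1) = - (2%:R * de) by rewrite fde; ring.
  by rewrite oppr_eq0 mulf_neq0 // ((pcharf0P L).1 char0L).
exists (1 *: p0 + (-1) *: p1) => //.
by apply: contraNneq fz => ->; rewrite (ev0_form fLf).
Qed.

Section Coordinates.
Variable s : K.
Hypothesis hs : forall i, crd (P i) 0 + s * crd (P i) 1 + s ^+ 2 * crd (P i) 2 != 0.

Let zK (q : 'rV[K]_3) := crd q 0 + s * crd q 1 + s ^+ 2 * crd q 2.
Let zL (q : 'rV[L]_3) := crd q 0 + iota s * crd q 1 + iota s ^+ 2 * crd q 2.
Let a i := crd (P i) 1 / zK (P i).
Let b i := crd (P i) 2 / zK (P i).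
Let aL := iota \o a.
Let bL := iota \o b.

Lemma veronese_unit : veronese a b \in unitmx.
Proof.
rewrite -row_free_unit -kermx_eq0; apply/eqP/row_matrixP => r.
have : row r (kermx (veronese a b)) *m veronese a b = 0.
  by rewrite -row_mul mulmx_ker row0.
rewrite row0; move: (row r _) => u uV.
have uc l : conic (crd u) (a l) (b l) 1 = 0.
  have /rowP /(_ l) := uV; rewrite [LHS]mxE [RHS]mxE => <-.
  rewrite conicE; apply: eq_bigr => m _.
  by rewrite [veronese _ _ _ _]mxE /crd inord_val.
(* A quadratic relation between the monomials at the affine points, read in
   the original coordinates, is a conic through the six points. *)
pose Z : mpoly 3 L := var (inord 0) + iota s *: var (inord 1) +
  iota s ^+ 2 *: var (inord 2).
pose d m := iota (crd u m).
pose Q := conic (fun m => mpolyC 3 (d m)) (var (inord 1)) (var (inord 2)) Z.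
have evQ q : ev Q q = conic d (crd q 1) (crd q 2) (zL q).
  have evZ' : ev Z q = zL q by rewrite !evD !evZ !evX !crdE.
  rewrite /Q /conic -evZ' /ev; rewrite !(rmorphD, rmorphM, rmorphXn) /=.
  by rewrite !mevalC !mevalXU.
have Zf : is_form 1 Z.
  by apply: is_formD; [apply: is_formD; [|apply: is_formZ]|apply: is_formZ];
    apply: is_form_var.
have Q0 : Q = 0.
  apply: no_conic => [|l].
    by apply: is_form_conic => //; apply: is_form_var.
  have := congr1 iota (uc l); rewrite rmorph0 => E0.
  rewrite evQ.
  have cL j : crd (PL l) j = iota (crd (P l) j) by rewrite /crd mxE.
  have zLE : zL (PL l) = iota (zK (P l)).
    by rewrite /zL /zK !cL !(rmorphD, rmorphM, rmorphXn).
  have z0 : zK (P l) != 0 by apply: hs.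
  have -> : crd (PL l) 1 = iota (zK (P l) * a l) by rewrite cL /a mulrC divfK.
  have -> : crd (PL l) 2 = iota (zK (P l) * b l) by rewrite cL /b mulrC divfK.
  have -> : conic d (iota (zK (P l) * a l)) (iota (zK (P l) * b l)) (zL (PL l)) =
      iota (zK (P l)) ^+ 2 * iota (conic (crd u) (a l) (b l) 1).
    rewrite zLE /conic /d !(rmorphD, rmorphM, rmorphXn) rmorph1 /=; ring.
  by rewrite E0 mulr0.
have c0 x y z : conic d x y z = 0.
  have := evQ (pt3 (z - iota s * x - iota s ^+ 2 * y) x y).
  rewrite Q0 {1}/ev meval0 /zL !crd_pt3 => E0.
  by rewrite [RHS]E0; congr conic; ring.
have d0 : d 0%N = 0 by rewrite -[RHS](c0 1 0 0) /conic; ring.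
have d2 : d 2%N = 0 by rewrite -[RHS](c0 0 1 0) /conic; ring.
have d5 : d 5%N = 0 by rewrite -[RHS](c0 0 0 1) /conic; ring.
have d1 : d 1%N = 0 by rewrite -[RHS](c0 1 1 0) /conic d0 d2; ring.
have d3 : d 3%N = 0 by rewrite -[RHS](c0 1 0 1) /conic d0 d5; ring.
have d4 : d 4%N = 0 by rewrite -[RHS](c0 0 1 1) /conic d2 d5; ring.
apply: rowP_crd => m mlt; rewrite [RHS]mxE; apply: (fmorph_inj iota).
by rewrite rmorph0; case: m mlt => [|[|[|[|[|[|//]]]]]] _.
Qed.

Let VuL : veronese aL bL \in unitmx.
Proof. by rewrite -veronese_map map_unitmx veronese_unit. Qed.

Let ZK : mpoly 3 K := var (inord 0) + s *: var (inord 1) + s ^+ 2 *: var (inord 2).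
Let hK j := hform a b (var (inord 1)) (var (inord 2)) ZK j.
Let hL j := map_mpoly iota (hK j).

Lemma ev_hK j q : ev (hK j) q = hcub (cc a b) (crd q 1) (crd q 2) (zK q) j.
Proof. by rewrite ev_hform !evD !evZ !evX !crdE. Qed.

Lemma ev_hL j q : ev (hL j) q = hcub (cc aL bL) (crd q 1) (crd q 2) (zL q) j.
Proof.
rewrite /hL hform_map !map_var ev_hform !evX !crdE; congr hcub.
rewrite /ZK !raddfD /= !map_mpolyZ !map_var !evD !evZ !evX !crdE.
by rewrite rmorphXn.
Qed.

Lemma hK_point (j : 'I_4) i : ev (hK j) (P i) = 0.
Proof.
have z0 : zK (P i) != 0 by apply: hs.
rewrite ev_hK; have := hcub_scale a b (zK (P i)) (a i) (b i) 1 j.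
rewrite hcub_point ?veronese_unit // mulr0 mulr1 => E0; rewrite -[RHS]E0.
by congr hcub; rewrite mulrC divfK.
Qed.

Lemma hL_through (j : 'I_4) : cubic_through (fun i => PL i) (hL j).
Proof.
split=> [|i]; last by rewrite ev_map hK_point rmorph0.
apply: map_is_form; apply: is_form_hform; try exact: is_form_var.
by apply: is_formD; [apply: is_formD; [|apply: is_formZ]|apply: is_formZ];
    apply: is_form_var.
Qed.

(** The canonical cubics through the points, taken over the small field, and
    the given g are two bases of the same space. *)
Lemma change_of_basis : exists2 A : 'M[L]_4, A \in unitmx &
  (forall q, param q = (\row_(j < 4) ev (hL j) q) *m A) /\
  (forall q t, \row_j dderiv (g j) q t = (\row_(j < 4) dderiv (hL j) q t) *m A).
Proof.
have /choice [S SE] (j : 'I_4) : exists c : 'I_4 -> L, hL j = \sum_i c i *: g i.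
  by apply/(gbasis.2 (hL j)); apply: hL_through.
pose M : 'M[L]_4 := \matrix_(i, j) S j i.
have GM q : \row_(j < 4) ev (hL j) q = param q *m M.
  apply/rowP => j; rewrite !mxE SE ev_sum; apply: eq_bigr => i _.
  by rewrite evZ !mxE mulrC.
have DM q t : \row_(j < 4) dderiv (hL j) q t = (\row_j dderiv (g j) q t) *m M.
  apply/rowP => j; rewrite !mxE SE dderiv_sum; apply: eq_bigr => i _.
  by rewrite dderivZ !mxE mulrC.
have Mu : M \in unitmx.
  rewrite -unitmx_tr -row_free_unit -kermx_eq0; apply/eqP/row_matrixP => r.
  have : row r (kermx M^T) *m M^T = 0 by rewrite -row_mul mulmx_ker row0.
  rewrite row0; move: (row r _) => u uM.
  (* A relation between the cubics in the original coordinates is one between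
     the canonical cubics, by the inverse change of coordinates [q']. *)
  have [ind _] := cubic_basis_gpoly char0L VuL (unitmx1 _ 4).
  apply/rowP => j; rewrite [RHS]mxE; move: j; apply: ind.
  apply: (mpoly_ev0 char0L) => q.
  have gE j : ev (gpoly aL bL 1%:M j) q = (\row_(i < 4) ev (hpoly aL bL i) q) 0 j.
    have /rowP /(_ j) := ev_gpoly aL bL 1%:M q.
    by rewrite mulmx1 [LHS]mxE.
  pose q' := pt3 (crd q 2 - iota s * crd q 0 - iota s ^+ 2 * crd q 1) (crd q 0) (crd q 1).
  have hE : \row_(i < 4) ev (hpoly aL bL i) q = \row_(i < 4) ev (hL i) q'.
    apply/rowP => i; rewrite !mxE ev_hpoly ev_hL /zL !crd_pt3; congr hcub; ring.
  rewrite ev_sum; transitivity (((\row_(i < 4) ev (hL i) q') *m u^T) 0 0).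
    rewrite mxE; apply: eq_bigr => j _; rewrite evZ gE hE mulrC; congr (_ * _).
    by rewrite mxE.
  by rewrite GM -mulmxA -[M]trmxK -trmx_mul uM trmx0 mulmx0 mxE.
exists (invmx M); first by rewrite unitmx_inv.
by split=> [q|q t]; rewrite ?GM ?DM mulmxK.
Qed.

Section Rationality.
Variable A : 'M[L]_4.
Hypothesis Au : A \in unitmx.
Hypothesis DA : forall q t,
  \row_j dderiv (g j) q t = (\row_(j < 4) dderiv (hL j) q t) *m A.

Let chordK i j : 'rV[K]_4 := \row_(m < 4) dderiv (hK m) (P i) (P j).

Lemma chordE i j : chord i j = map_mx iota (chordK i j) *m A.
Proof.
by rewrite /chord /tangent DA; congr (_ *m _); apply/rowP => m; rewrite !mxE -dderiv_map.
Qed.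

Lemma chord_select i j1 j2 j3 e : e \in E i -> e != 0 ->
  uniq [:: i; j1; j2; j3] ->
  exists j m al be, [/\ i != j, i != m & j != m] /\
    [/\ al != 0, be != 0 & e = al *: chord i j + be *: chord i m].
Proof.
move=> eE e0; rewrite /= !inE !negb_or -!andbA andbT.
move=> /and3P [i1 i2 /and3P [i3 n12 /andP [n13 n23]]].
have [p [q [al [be [pq al0 be0 ee]]]]] := select2 (Eline i).1
  (And4 (chord_mem i j1) (chord_mem i j2) (chord_mem i j3) eE) e0
  (And3 (chord_indep i1 i2 n12) (chord_indep i1 i3 n13) (chord_indep i2 i3 n23)).
case: pq ee => [[-> ->]|[[-> ->]|[-> ->]]] ee.
- by exists j1, j2, al, be.
- by exists j1, j3, al, be.
- by exists j2, j3, al, be.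
Qed.

(** Two chord points on E_0 and two on E_1 form, together with a chord point
    on E_2, a projective frame; they are rational, and so are their preimages
    under A. *)
Lemma A_rational : exists mu (B : 'M[K]_4),
  [/\ mu != 0, B \in unitmx & A = mu *: map_mx iota B].
Proof.
pose o (m : nat) : 'I_6 := inord m.
have oE m m' : (m < 6)%N -> (m' < 6)%N -> (o m == o m') = (m == m').
  by move=> ? ?; rewrite -val_eqE /= !inordK.
have o01 : o 0%N != o 1%N by rewrite oE.
have [e0 [e1 [e0E e1E yE]]] := E01_full (chord (o 2) (o 3)).
have y0 : chord (o 2) (o 3) != 0 by apply: chord_neq0; rewrite oE.
have e0n : e0 != 0.
  apply: contraNneq y0 => z; apply/eqP; apply: (@E_disjoint (o 1) (o 2)).
  - by rewrite oE.
  - by rewrite yE z add0r.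
  exact: chord_mem.
have e1n : e1 != 0.
  apply: contraNneq y0 => z; apply/eqP; apply: (@E_disjoint (o 0%N) (o 2)).
  - by rewrite oE.
  - by rewrite yE z addr0.
  exact: chord_mem.
have [|j [j' [al [be [[n1 n2 n3] [al0 be0 e0V]]]]]] :=
    @chord_select (o 0%N) (o 1%N) (o 2) (o 3) e0 e0E e0n.
  by rewrite /= !inE !oE.
have [|m [m' [ga [de [[k1 k2 k3] [ga0 de0 e1V]]]]]] :=
    @chord_select (o 1%N) (o 0%N) (o 2) (o 3) e1 e1E e1n.
  by rewrite /= !inE !oE.
(* The frame: two chord points on E_0 and two on E_1, in this order. *)
pose src (r : nat) : 'I_6 := match r with 0 | 1 => o 0%N | _ => o 1%N end.
pose tgt (r : nat) : 'I_6 := match r with 0 => j | 1 => j' | 2 => m | _ => m' end.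
pose co (r : nat) : L := match r with 0 => al | 1 => be | 2 => ga | _ => de end.
have st (r : 'I_4) : src r != tgt r by case: r => [[|[|[|[|//]]]] ?].
have /choice [la /choice [U VU]] (r : 'I_4) : exists la u,
    chord (src r) (tgt r) = la *: map_mx iota u.
  exact: chord_rational (st r).
pose X : 'M[K]_4 := \matrix_(r < 4) chordK (src r) (tgt r).
have rowXA r : row r (map_mx iota X *m A) = chord (src r) (tgt r).
  by rewrite row_mul -map_row rowK -chordE.
have comb (u : 'rV[L]_4) : u *m (map_mx iota X *m A) =
    (crd u 0 *: chord (o 0%N) j + crd u 1 *: chord (o 0%N) j') +
    (crd u 2 *: chord (o 1%N) m + crd u 3 *: chord (o 1%N) m').
  rewrite mulmx_sum_row; under eq_bigr => r _ do rewrite rowXA -[r in u 0 r]inord_val.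
  by rewrite (sum_ord4 (fun r => crd u r *: chord (src r) (tgt r))) !addrA.
have XAu : map_mx iota X *m A \in unitmx.
  rewrite -row_free_unit -kermx_eq0; apply/eqP/row_matrixP => r.
  have : row r (kermx (map_mx iota X *m A)) *m (map_mx iota X *m A) = 0.
    by rewrite -row_mul mulmx_ker row0.
  rewrite row0; move: (row r _) => u; rewrite comb => /eqP.
  rewrite addr_eq0 => /eqP E0.
  have u0 : crd u 0 *: chord (o 0%N) j + crd u 1 *: chord (o 0%N) j' = 0.
    apply: (E_disjoint o01); first by rewrite memvD ?memvZ ?chord_mem.
    by rewrite E0 memvN memvD ?memvZ ?chord_mem.
  have [z0 z1] := chord_indep n1 n2 n3 u0.
  have [z2 z3] : crd u 2 = 0 /\ crd u 3 = 0.
    apply: (chord_indep k1 k2 k3); apply/eqP; rewrite -oppr_eq0 -E0 u0; exact/eqP.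
  apply: rowP_crd => i ilt; rewrite [RHS]mxE.
  by case: i ilt => [|[|[|[|//]]]].
have [mu [u yu]] : exists mu (u : 'rV[K]_4), chord (o 2) (o 3) = mu *: map_mx iota u.
  by apply: chord_rational; rewrite oE.
have Xu : X \in unitmx.
  by rewrite -(map_unitmx iota); move: XAu; rewrite unitmx_mul => /andP [].
have [B AB] : exists B : 'M[K]_4, A = mu *: map_mx iota B.
  apply: (@frame_rational _ _ iota 4 A X (\matrix_r U r) (chordK (o 2) (o 3)) u
    (\row_r la r) (\row_(r < 4) co r)) => //.
  - by move=> r; rewrite rowXA VU mxE -map_row rowK.
  - by rewrite -chordE.
  - apply: (can_inj (mulmxK Au)); rewrite -chordE -mulmxA comb !(crd_row co) // yE.
    by rewrite e0V e1V.
  by move=> r; rewrite mxE; case: r => [[|[|[|[|//]]]] ?].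
have mu0 : mu != 0.
  by apply: contraNneq y0 => z; rewrite yu z scale0r.
exists mu, B; split=> //; move: Au; rewrite AB unitmxZ ?unitfE //.
by rewrite map_unitmx.
Qed.

End Rationality.

(** Over the large field the equation obtained from the matrix A is a
    multiple of f. Replacing A by its rational multiple B only changes the
    scalar, which is then a quotient of coefficients in the small field. *)
Lemma coordinates_model : exists (B : 'M[K]_4) (ka : K),
  [/\ B \in unitmx, ka != 0 & Fpoly a b B = ka *: f].
Proof.
have [A Au [GA DA]] := change_of_basis.
have [mu [B [mu0 Bu AB]]] := A_rational Au DA.
pose r q := pt3 (crd q 1) (crd q 2) (zL q).
have Gr q : param q = \row_j ev (gpoly aL bL A j) (r q).
  rewrite GA ev_gpoly; congr (_ *m _); apply/rowP => j.
  by rewrite !mxE ev_hL ev_hpoly !crd_pt3.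
have rsurj q : exists q', q = r q'.
  exists (pt3 (crd q 2 - iota s * crd q 0 - iota s ^+ 2 * crd q 1) (crd q 0) (crd q 1)).
  apply: rowP_crd => j jlt; rewrite /r /zL !crd_pt3.
  by case: j jlt => [|[|[|//]]] _; rewrite crd_pt3 //; ring.
have Fzl : zero_locus fL = zero_locus (Fpoly aL bL A).
  rewrite zl (surface_eq char0L VuL Au); congr zariski_closure.
  apply/seteqP; split=> x [x0 [q xq]]; split=> //.
    by exists (r q); rewrite -Gr.
  by have [q' qq] := rsurj q; exists q'; rewrite xq qq -Gr.
have [p0 [p1 [de [de0 fde]]]] := transversal.
have [ka FA] : exists ka, Fpoly aL bL A = ka *: fL.
  apply: (cubic_unique char0L fLf (is_form_Fpoly aL bL A) de0 fde) => x.
  by rewrite Fzl => -[].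
have [z z0 fz] := f_nonzero_at.
have ka0 : ka != 0.
  apply: contraNneq fz => ka0; suff : zero_locus fL z by case=> _ ->.
  by rewrite Fzl; split=> //; rewrite FA ka0 scale0r /ev meval0.
have FB : map_mpoly iota (Fpoly a b B) = (mu ^+ 3 * ka) *: fL.
  rewrite Fpoly_map -scalerA -FA AB (Fpoly_scale _ _ char0L mu0) ?map_unitmx //.
  by rewrite scalerA mulfV ?scale1r // expf_neq0.
have [m fm] : exists m, mcoeff m f != 0.
  apply: contrapT => /forallNP H; move/eqP: fz; apply.
  suff -> : f = 0 by rewrite raddf0 /ev meval0.
  by apply/mpolyP => m; rewrite mcoeff0; apply/eqP/negPn/negP.
have kaE : mu ^+ 3 * ka = iota (mcoeff m (Fpoly a b B) / mcoeff m f).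
  have := congr1 (fun p => mcoeff m p) FB.
  rewrite mcoeff_map_mpoly mcoeffZ mcoeff_map_mpoly => E0.
  by rewrite rmorphM fmorphV /= E0 mulfK // fmorph_eq0.
exists B, (mcoeff m (Fpoly a b B) / mcoeff m f); split=> //.
  by rewrite -(fmorph_eq0 iota) -kaE mulf_neq0 ?expf_neq0.
by apply: (@map_mpoly_inj _ _ iota); rewrite FB map_mpolyZ kaE.
Qed.

End Coordinates.

(** A linear form that vanishes at none of the six points exists because the
    field is infinite; it serves as the coordinate z. *)
Lemma rational_model : exists (a b : 'I_6 -> K) (B : 'M[K]_4) (ka : K),
  [/\ veronese a b \in unitmx, B \in unitmx, ka != 0 & Fpoly a b B = ka *: f].
Proof.
have [s hs] : exists s : K, forall i,
    crd (P i) 0 + s * crd (P i) 1 + s ^+ 2 * crd (P i) 2 != 0.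
  (* The form x + s y + s^2 z, for s not a root of any of these polynomials. *)
  pose p i : {poly K} := Poly [:: crd (P i) 0; crd (P i) 1; crd (P i) 2].
  have pE i s : (p i).[s] = crd (P i) 0 + s * crd (P i) 1 + s ^+ 2 * crd (P i) 2.
    by rewrite horner_Poly /=; ring.
  have p0 : \prod_i p i != 0.
    apply/prodf_neq0 => i _; apply: contraNneq (sixP.1 i) => p0.
    apply/eqP; rewrite -(map_mx0 iota); congr map_mx; apply: rowP_crd => j jlt.
    rewrite [RHS]mxE; have := congr1 (fun q : {poly K} => q`_j) p0.
    by rewrite coef_Poly coef0; case: j jlt => [|[|[|//]]].
  apply: contrapT => /forallNP H; move/eqP: p0; apply.
  apply: (poly0_nat char0) => n; have /existsNP [i /negP] := H n.+1%:R.
  rewrite negbK -pE => /eqP pi0.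
  by rewrite horner_prod (bigD1 i) //= pi0 mul0r.
have [B [ka [Bu ka0 FB]]] := coordinates_model hs.
by do 2!eexists; exists B, ka; split; [exact: (veronese_unit hs) | | | exact: FB].
Qed.

End Descent.

(** * Valuations *)

Section RatrChar0.
Variable K : fieldType.
(** [ratr] under a name that carries the assumption on the characteristic, on
    which its being a ring morphism depends. *)
Definition ratK (char0 : [pchar K] =i pred0) : rat -> K := @ratr K.
Variable char0 : [pchar K] =i pred0.

Let intK_neq0 (d : int) : d != 0 -> d%:~R != 0 :> K.
Proof.
case: d => n n0.
  by rewrite -[_%:~R]/(n%:R) ((pcharf0P K).1 char0).
by rewrite -[_%:~R]/(- n.+1%:R) oppr_eq0 ((pcharf0P K).1 char0).
Qed.

Let ratK_frac (n d : int) : d != 0 -> ratK char0 (n%:~R / d%:~R) = n%:~R / d%:~R.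
Proof.
move=> d0; set x : rat := n%:~R / d%:~R.
have dQ : d%:~R != 0 :> rat by rewrite intr_eq0.
have e : numq x * d = n * denq x.
  apply: (@intr_inj rat); rewrite !rmorphM /= numqE /x; field.
  exact: dQ.
have eK := congr1 (fun m : int => m%:~R : K) e; rewrite !rmorphM /= in eK.
by apply/eqP; rewrite /ratK /ratr eqr_div ?intK_neq0 ?denq_eq0 // eK.
Qed.

Let ratK_zmod : zmod_morphism (ratK char0).
Proof.
move=> x y; have dx := denq_neq0 x; have dy := denq_neq0 y.
rewrite -[x in LHS]divq_num_den -[y in LHS]divq_num_den.
have -> : (numq x)%:~R / (denq x)%:~R - (numq y)%:~R / (denq y)%:~R =
    (numq x * denq y - numq y * denq x)%:~R / (denq x * denq y)%:~R :> rat.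
  by rewrite rmorphB !rmorphM /=; field; rewrite !intr_eq0 dx dy.
rewrite ratK_frac ?mulf_neq0 // rmorphB !rmorphM /= /ratK /ratr.
by field; rewrite !intK_neq0.
Qed.

Let ratK_monoid : monoid_morphism (ratK char0).
Proof.
split=> [|x y]; first by rewrite /ratK -[1]/(1%:R) ratr_nat.
have dx := denq_neq0 x; have dy := denq_neq0 y.
rewrite -[x in LHS]divq_num_den -[y in LHS]divq_num_den.
have -> : (numq x)%:~R / (denq x)%:~R * ((numq y)%:~R / (denq y)%:~R) =
    (numq x * numq y)%:~R / (denq x * denq y)%:~R :> rat.
  by rewrite !rmorphM /=; field; rewrite !intr_eq0 dx dy.
rewrite ratK_frac ?mulf_neq0 // !rmorphM /= /ratK /ratr.
by field; rewrite !intK_neq0.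
Qed.

HB.instance Definition _ := GRing.isZmodMorphism.Build rat K (ratK char0) ratK_zmod.
HB.instance Definition _ := GRing.isMonoidMorphism.Build rat K (ratK char0) ratK_monoid.

End RatrChar0.

Section Valuation.
Variables (R : realType) (K : fieldType) (v : K -> \bar R).
Hypothesis vP : is_valuation v.
Local Open Scope ereal_scope.

Lemma val_fin x : x != 0%R -> v x \is a fin_num.
Proof.
move=> x0; rewrite fin_numE; apply/andP; split; apply/eqP.
  exact: valuation_nnoo.
by move/(valuation_eqoo vP)/eqP; rewrite (negbTE x0).
Qed.

Lemma val_zero : v 0%R = +oo.
Proof. exact/(valuation_eqoo vP). Qed.

Lemma val_one : v 1%R = 0.
Proof.
have := valuationM vP 1%R 1%R; rewrite mulr1.
rewrite -(fineK (val_fin (oner_neq0 K))) -EFinD => -[] e.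
by congr EFin; apply: (addrI (fine (v 1%R))); rewrite addr0 -e.
Qed.

Lemma val_opp x : v (- x)%R = v x.
Proof.
have vN1 : v (-1)%R = 0.
  have n1 : (-1)%R != 0%R :> K by rewrite oppr_eq0 oner_neq0.
  have := valuationM vP (-1)%R (-1)%R; rewrite mulrNN mulr1 val_one.
  rewrite -(fineK (val_fin n1)) -EFinD => -[] e.
  congr EFin; have /eqP : (fine (v (-1)) *+ 2 = 0)%R by rewrite mulr2n -e.
  by rewrite mulrn_eq0 => /eqP.
by rewrite -mulN1r (valuationM vP) vN1 add0e.
Qed.

Lemma valD_ge x y (e : \bar R) : e <= v x -> e <= v y -> e <= v (x + y)%R.
Proof.
move=> ex ey; apply: le_trans (valuationD vP x y).
by rewrite le_min ex.
Qed.

(** An ultrametric triangle is isosceles. *)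
Lemma val_dominant x y : v x < v (x - y)%R -> v y = v x.
Proof.
move=> lt; apply/le_anti/andP; split.
  rewrite leNgt; apply/negP => xy.
  have : v x < v (y + (x - y))%R.
    apply: lt_le_trans (valuationD vP _ _).
    by rewrite lt_min xy.
  by rewrite addrC subrK ltxx.
have -> : y = (x + - (x - y))%R by rewrite opprB addrC subrK.
by apply: valD_ge => //; rewrite val_opp ltW.
Qed.

Lemma val_lower x : exists M : nat, (- M%:R)%:E <= v x.
Proof.
have [->|x0] := eqVneq x 0%R; first by exists 0%N; rewrite val_zero leey.
exists (Num.trunc `|fine (v x)|%R).+1.
rewrite -(fineK (val_fin x0)) lee_fin lerNl.
have := truncnS_gt `|fine (v x)|%R; move/ltW; apply: le_trans.
by rewrite -normrN ler_norm.
Qed.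

Lemma val_mul_small x : exists M : nat, forall (N : nat) y,
  (N + M)%:R%:E <= v y -> N%:R%:E <= v (x * y)%R.
Proof.
have [M Mx] := val_lower x; exists M => N y Ny.
rewrite (valuationM vP).
have -> : N%:R%:E = (- M%:R)%:E + (N + M)%:R%:E :> \bar R.
  by rewrite -EFinD natrD; congr EFin; rewrite addrC addrK.
exact: leeD.
Qed.

Lemma val_le_nat (M N : nat) x : (M <= N)%N -> N%:R%:E <= v x -> M%:R%:E <= v x.
Proof. by move=> MN; apply: le_trans; rewrite lee_fin ler_nat. Qed.

End Valuation.

(** * Limits of sequences of rational numbers *)

Definition eventually_nat (Q : nat -> Prop) : Prop :=
  exists n0, forall n, (n0 <= n)%N -> Q n.

Lemma eventually_and Q1 Q2 : eventually_nat Q1 -> eventually_nat Q2 ->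
  eventually_nat (fun n => Q1 n /\ Q2 n).
Proof.
move=> [n1 H1] [n2 H2]; exists (maxn n1 n2) => n.
by rewrite geq_max => /andP [l1 l2]; split; [apply: H1 | apply: H2].
Qed.

Lemma eventually_fin (I : finType) (Q : I -> nat -> Prop) :
  (forall i, eventually_nat (Q i)) -> eventually_nat (fun n => forall i, Q i n).
Proof.
move=> /choice [n0 H]; exists (\max_i n0 i) => n le i; apply: H.
exact: leq_trans (leq_bigmax i) le.
Qed.

Section Limits.
Variables (R : realType) (K : fieldType) (v : K -> \bar R).
Hypothesis vP : is_valuation v.
Variable phi : {rmorphism rat -> K}.

Definition small (N : nat) (x : K) := (N%:R%:E <= v x)%E.

Definition lim_to (u : nat -> rat) (x : K) : Prop :=
  forall N, eventually_nat (fun n => small N (x - phi (u n))).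

Lemma smallD N x y : small N x -> small N y -> small N (x + y).
Proof. exact: valD_ge. Qed.

Lemma smallN N x : small N x -> small N (- x).
Proof. by rewrite /small val_opp. Qed.

Lemma small_mul x : exists M, forall N y, small (N + M) y -> small N (x * y).
Proof. exact: val_mul_small. Qed.

Lemma lim_const c : lim_to (fun=> c) (phi c).
Proof. by move=> N; exists 0%N => n _; rewrite subrr /small val_zero ?leey. Qed.

Lemma limD u x u' x' : lim_to u x -> lim_to u' x' ->
  lim_to (fun n => u n + u' n) (x + x').
Proof.
move=> ux ux' N; have [n0 H] := eventually_and (ux N) (ux' N).
exists n0 => n /H [s s']; rewrite rmorphD opprD addrACA.
exact: smallD.
Qed.

Lemma limN u x : lim_to u x -> lim_to (fun n => - u n) (- x).
Proof.
move=> ux N; have [n0 H] := ux N; exists n0 => n /H s.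
by rewrite rmorphN -opprD; apply: smallN.
Qed.

Lemma limM u x u' x' : lim_to u x -> lim_to u' x' ->
  lim_to (fun n => u n * u' n) (x * x').
Proof.
move=> ux ux' N; have [M HM] := small_mul x; have [M' HM'] := small_mul x'.
have [n0 H] := eventually_and (ux (N + M')%N) (ux' (N + M)%N).
have [n1 H1] := eventually_and (ux N) (ux' 0%N).
exists (maxn n0 n1) => n; rewrite geq_max => /andP [/H [s s'] /H1 [t t']].
have -> : x * x' - phi (u n * u' n) = x * (x' - phi (u' n)) +
    x' * (x - phi (u n)) - (x - phi (u n)) * (x' - phi (u' n)).
  by rewrite rmorphM; ring.
apply: smallD; first by apply: smallD; [apply: HM | apply: HM'].
apply: smallN; rewrite /small (valuationM vP) -[N%:R]addr0 EFinD.
exact: leeD.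
Qed.

Lemma lim_sum (I : finType) (u : I -> nat -> rat) (x : I -> K) (p : pred I) :
  (forall i, lim_to (u i) (x i)) ->
  lim_to (fun n => \sum_(i | p i) u i n) (\sum_(i | p i) x i).
Proof.
move=> H; elim: (index_enum I) => [|i s IH].
  rewrite big_nil (_ : (fun _ => _) = fun=> 0) -?(rmorph0 phi); last first.
    by apply/funext => n; rewrite big_nil.
  exact: lim_const.
rewrite big_cons; under eq_fun do rewrite big_cons.
by case: (p i) => //; apply: limD.
Qed.

Lemma lim_prod (I : finType) (u : I -> nat -> rat) (x : I -> K) :
  (forall i, lim_to (u i) (x i)) ->
  lim_to (fun n => \prod_i u i n) (\prod_i x i).
Proof.
move=> H; elim: (index_enum I) => [|i s IH].
  rewrite big_nil (_ : (fun _ => _) = fun=> 1) -?(rmorph1 phi); last first.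
    by apply/funext => n; rewrite big_nil.
  exact: lim_const.
by rewrite big_cons; under eq_fun do rewrite big_cons; apply: limM.
Qed.

Lemma limXn u x m : lim_to u x -> lim_to (fun n => u n ^+ m) (x ^+ m).
Proof.
move=> ux; elim: m => [|m IH].
  by rewrite expr0 -(rmorph1 phi); apply: lim_const.
by rewrite exprS; under eq_fun do rewrite exprS; apply: limM.
Qed.

(** A nonzero limit has the valuation of all late terms; this is where the
    tropicalization of the approximation comes from. *)
Lemma lim_val u x : lim_to u x -> x != 0 ->
  eventually_nat (fun n => v (phi (u n)) = v x).
Proof.
move=> ux x0; have [M Mx] := val_lower vP x^-1.
have [n0 H] := ux M.+1; exists n0 => n /H s.
apply: val_dominant => //; apply: lt_le_trans s.
have := valuationM vP x x^-1; rewrite mulfV // val_one //.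
have := val_fin vP x0; have := val_fin vP (invr_neq0 x0).
move: Mx; case: (v x^-1) => // r; case: (v x) => // r' rM _ _ [] e.
rewrite lte_fin; move: rM; rewrite lee_fin lerNl.
have -> : r' = - r by apply/eqP; rewrite -addr_eq0 -e.
move=> /le_lt_trans; apply; by rewrite ltr_nat.
Qed.

Lemma lim_neq0 u x : lim_to u x -> x != 0 -> eventually_nat (fun n => u n != 0).
Proof.
move=> ux x0; have [n0 H] := lim_val ux x0; exists n0 => n /H e.
apply: contraNneq x0 => u0; move: e; rewrite u0 rmorph0 val_zero // => /esym e.
exact/eqP/(valuation_eqoo vP).
Qed.

Lemma limV u x : lim_to u x -> x != 0 -> lim_to (fun n => (u n)^-1) x^-1.
Proof.
move=> ux x0 N; have [M HM] := small_mul (x^-1 ^+ 2).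
have [n0 H] := eventually_and (ux (N + M)%N)
  (eventually_and (lim_val ux x0) (lim_neq0 ux x0)).
exists n0 => n /H [s [e u0]].
have p0 : phi (u n) != 0 by rewrite fmorph_eq0.
(* The last factor has valuation 0, since u n and x have the same valuation. *)
have -> : x^-1 - phi (u n)^-1 = (x^-1 ^+ 2 * - (x - phi (u n))) * (x / phi (u n)).
  by rewrite fmorphV; field; rewrite x0 p0.
have vq : v (x / phi (u n)) = 0%E.
  have := valuationM vP (x / phi (u n)) (phi (u n)); rewrite divfK // e.
  have := val_fin vP x0; case: (v x) => // r _.
  have q0 : x / phi (u n) != 0 by rewrite mulf_neq0 ?invr_neq0.
  have := val_fin vP q0; case: (v _) => // r' _ [] /eqP.
  by rewrite -{1}[r]add0r => /eqP /addIr <-.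
rewrite /small (valuationM vP) vq adde0; apply: HM; exact: smallN.
Qed.

Definition mlim m n (U : nat -> 'M[rat]_(m, n)) (X : 'M[K]_(m, n)) : Prop :=
  forall i j, lim_to (fun r => U r i j) (X i j).

Lemma mlimM m n q (U : nat -> 'M[rat]_(m, n)) X (W : nat -> 'M[rat]_(n, q)) Y :
  mlim U X -> mlim W Y -> mlim (fun r => U r *m W r) (X *m Y).
Proof.
move=> UX WY i j; rewrite mxE; under eq_fun do rewrite mxE.
by apply: lim_sum => l; apply: limM.
Qed.

Lemma mlim_det n (U : nat -> 'M[rat]_n) X :
  mlim U X -> lim_to (fun r => \det (U r)) (\det X).
Proof.
move=> UX; rewrite /determinant; apply: lim_sum => s; apply: limM.
  rewrite -(rmorph1 phi) -rmorphN -rmorphXn; exact: lim_const.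
by apply: lim_prod => i; apply: UX.
Qed.

Lemma mlim_unit n (U : nat -> 'M[rat]_n) X : mlim U X -> X \in unitmx ->
  eventually_nat (fun r => U r \in unitmx).
Proof.
move=> UX; rewrite unitmxE unitfE => d0.
have [n0 H] := lim_neq0 (mlim_det UX) d0.
by exists n0 => r /H; rewrite unitmxE unitfE.
Qed.

Lemma lim_eventually u u' x : lim_to u x -> eventually_nat (fun n => u n = u' n) ->
  lim_to u' x.
Proof.
by move=> ux e N; have [n0 H] := eventually_and (ux N) e; exists n0 => n /H [+ <-].
Qed.

Lemma mlimV n (U : nat -> 'M[rat]_n) X : mlim U X -> X \in unitmx ->
  mlim (fun r => invmx (U r)) (invmx X).
Proof.
move=> UX Xu i j.
apply: (@lim_eventually (fun r => (\det (U r))^-1 * (\adj (U r)) i j)).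
  rewrite /invmx Xu mxE; apply: limM.
    by apply: limV (mlim_det UX) _; rewrite -unitfE -unitmxE.
  rewrite mxE; under eq_fun do rewrite mxE.
  apply: limM.
    rewrite -(rmorph1 phi) -rmorphN -rmorphXn; exact: lim_const.
  apply: mlim_det => i' j'; rewrite !mxE; under eq_fun do rewrite !mxE.
  exact: UX.
have [n0 H] := mlim_unit UX Xu; exists n0 => r /H Uu.
by rewrite /invmx Uu [RHS]mxE.
Qed.

Definition plim n (F : nat -> mpoly n rat) (G : mpoly n K) : Prop :=
  forall m, lim_to (fun r => mcoeff m (F r)) (mcoeff m G).

Section PolyLimits.
Variable n : nat.
Implicit Types (F : nat -> mpoly n rat) (G : mpoly n K).

Lemma plimD F G F' G' : plim F G -> plim F' G' ->
  plim (fun r => F r + F' r) (G + G').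
Proof.
move=> H H' m; rewrite mcoeffD; under eq_fun do rewrite mcoeffD.
exact: limD.
Qed.

Lemma plimN F G : plim F G -> plim (fun r => - F r) (- G).
Proof.
move=> H m; rewrite mcoeffN; under eq_fun do rewrite mcoeffN.
exact: limN.
Qed.

Lemma plimB F G F' G' : plim F G -> plim F' G' ->
  plim (fun r => F r - F' r) (G - G').
Proof. by move=> H H'; apply: plimD => //; apply: plimN. Qed.

Lemma plimM F G F' G' : plim F G -> plim F' G' ->
  plim (fun r => F r * F' r) (G * G').
Proof.
move=> H H' m; rewrite mcoeffM; under eq_fun do rewrite mcoeffM.
by apply: lim_sum => i; apply: limM.
Qed.

Lemma plimXn F G e : plim F G -> plim (fun r => F r ^+ e.+1) (G ^+ e.+1).
Proof.
move=> H; elim: e => [|e IH]; first by [].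
by rewrite exprS; under eq_fun do rewrite exprS; apply: plimM.
Qed.

Lemma plimC u x : lim_to u x -> plim (fun r => mpolyC n (u r)) (mpolyC n x).
Proof.
move=> ux m; rewrite mcoeffC; under eq_fun do rewrite mcoeffC.
apply: limM => //; rewrite -(rmorph_nat phi); exact: lim_const.
Qed.

Lemma plimZX u x (i : 'I_n) : lim_to u x -> plim (fun r => u r *: var i) (x *: var i).
Proof.
move=> ux m; rewrite mcoeffZ mcoeffX; under eq_fun do rewrite mcoeffZ mcoeffX.
apply: limM => //; rewrite -(rmorph_nat phi); exact: lim_const.
Qed.

Lemma plim_sum (I : finType) (F : I -> nat -> mpoly n rat) (G : I -> mpoly n K) :
  (forall i, plim (F i) (G i)) -> plim (fun r => \sum_i F i r) (\sum_i G i).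
Proof.
move=> H m; rewrite raddf_sum; under eq_fun do rewrite raddf_sum.
by apply: lim_sum => i; apply: H.
Qed.

Lemma plim_detF (cn : nat -> nat -> nat -> mpoly n rat) (c : nat -> nat -> mpoly n K)
    (un : nat -> nat -> mpoly n rat) (u : nat -> mpoly n K) :
  (forall j m, plim (fun r => cn r j m) (c j m)) ->
  (forall j, plim (fun r => un r j) (u j)) ->
  plim (fun r => detF (cn r) (un r)) (detF c u).
Proof.
move=> Hc Hu.
have Hs i : plim (fun r => syzdot (cn r) i (un r)) (syzdot c i u).
  rewrite /syzdot /syz; do !apply: plimD; apply: plimM => //;
    by [apply: plimN | apply: plimB].
have Hu2 j : plim (fun r => un r j ^+ 2) (u j ^+ 2) by apply: plimXn.
have Huu i j : plim (fun r => un r i * un r j) (u i * u j) by apply: plimM.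
by rewrite /detF; apply: plimD; [apply: plimD|]; apply: plimM => //; apply: plimB.
Qed.

End PolyLimits.

Variables (a b : 'I_6 -> K) (B : 'M[K]_4).
Variables (an bn : nat -> 'I_6 -> rat) (Bn : nat -> 'M[rat]_4).
Hypothesis aE : forall l, lim_to (fun r => an r l) (a l).
Hypothesis bE : forall l, lim_to (fun r => bn r l) (b l).
Hypothesis BE : mlim Bn B.
Hypothesis Vu : veronese a b \in unitmx.
Hypothesis Bu : B \in unitmx.

Lemma lim_one : lim_to (fun=> 1) 1.
Proof. by rewrite -(rmorph1 phi); apply: lim_const. Qed.

Lemma lim_mon2 u x u' x' u'' x'' m : lim_to u x -> lim_to u' x' -> lim_to u'' x'' ->
  lim_to (fun r => mon2 (u r) (u' r) (u'' r) m) (mon2 x x' x'' m).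
Proof.
by move=> *; case: m => [|[|[|[|[|m]]]]] /=; (exact: limXn || exact: limM).
Qed.

Lemma lim_mon3 u x u' x' j : lim_to u x -> lim_to u' x' ->
  lim_to (fun r => mon3 (u r) (u' r) j) (mon3 x x' j).
Proof.
move=> ux ux'; case: j => [|[|[|j]]] /=; try exact: limXn.
  by apply: limM => //; apply: limXn.
by apply: limM => //; apply: limXn.
Qed.

Lemma veronese_lim : mlim (fun r => veronese (an r) (bn r)) (veronese a b).
Proof.
move=> m l; rewrite mxE; under eq_fun do rewrite mxE.
by apply: lim_mon2 => //; apply: lim_one.
Qed.

Lemma cc_lim j m : lim_to (fun r => cc (an r) (bn r) j m) (cc a b j m).
Proof.
apply: mlimM; last exact: mlimV veronese_lim Vu.
move=> i l; rewrite !mxE; under eq_fun do rewrite !mxE.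
by apply: limN; apply: lim_mon3.
Qed.

(** Every step of the closed formula for the equation is continuous where the
    Veronese matrix and B are invertible. *)
Lemma Fpoly_lim : plim (fun r => Fpoly (an r) (bn r) (Bn r)) (Fpoly a b B).
Proof.
rewrite Fpoly.unlock; apply: (@plim_detF 4 (fun r => ccp (an r) (bn r) 4) _
  (fun r j => \sum_i invmx (Bn r) i (inord j) *: var i)) => [j m|j].
  by apply: plimC; apply: cc_lim.
by apply: plim_sum => i; apply: plimZX; apply: mlimV.
Qed.

End Limits.

(** * Approximation of the surface over the rationals *)

(** Adding a constant to all heights does not change which terms attain the
    minimum. *)
Lemma trop_surface_shift (R : realType) (h h' : multinom 4 -> \bar R) (e : \bar R) :
  e \is a fin_num -> (forall a, mdeg a = 3 -> h a = (e + h' a)%E) ->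
  trop_surface h = trop_surface h'.
Proof.
move=> ef hE.
have termE u a : mdeg a = 3 -> trop_term h u a = (e + trop_term h' u a)%E.
  by move=> a3; rewrite /trop_term hE // addeA.
have cellE u : cell h u = cell h' u.
  apply/seteqP; split=> a [a3 aE]; split=> // b b3; have := aE b b3;
    by rewrite !termE // leeD2lE.
by apply/seteqP; split=> u [a [b [ca cb ab]]]; exists a, b; split=> //;
  rewrite ?cellE // -cellE.
Qed.

Section Padic.
Variables (R : realType) (p : nat) (K : fieldType) (v : K -> \bar R).
Hypothesis hK : is_padic_field p v.

Lemma padic_char0 : [pchar K] =i pred0.
Proof.
apply/(pcharf0P K) => -[|n]; first by rewrite mulr0n !eqxx.
apply/negbTE/eqP => n0.
have := padic_ratr hK n.+1%:R; rewrite ratr_nat n0 /padic_val.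
rewrite (pnatr_eq0 rat) /= => e.
by have := (valuation_eqoo (padic_valuation hK) 0).2 erefl; rewrite e.
Qed.

Lemma padic_approx (phi : {rmorphism rat -> K}) (x : K) : phi =1 ratr ->
  exists u, lim_to v phi u x.
Proof.
move=> phiE; have /choice [u uP] := padic_dense hK x.
exists u => N; exists N => n Nn; rewrite phiE.
exact: val_le_nat Nn (uP n).
Qed.

End Padic.

Theorem theorem4p3 (R : realType) (p : nat) (hp : prime p)
  (Qp : fieldType) (v : Qp -> \bar R) (hQp : is_padic_field p v)
  (Qpbar : closedFieldType) (iota : {rmorphism Qp -> Qpbar})
  (w : Qpbar -> \bar R) (hQpbar : is_valued_closure v iota w)
  (hconj : lines_conjecture v iota w)
  (f : mpoly 4 Qp) (hf : is_form 3 f) (hfull : full_support f)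
  (hsmooth : tropically_smooth v f) :
  exists (P : 'I_6 -> 'rV[rat]_3) (g : 'I_4 -> mpoly 3 rat),
    [/\ six_points P, cubic_basis P g &
        exists F : mpoly 4 rat,
          [/\ is_form 3 F,
              zero_locus (map_mpoly (ratr : rat -> algC) F) =
                resulting_surface (fun j => map_mpoly (ratr : rat -> algC) (g j)) &
              trop_surface (coef_val (padic_val R p) F) =
                trop_surface (coef_val v f)]].
Proof.
have char0 := padic_char0 hQp.
have vP := padic_valuation hQp.
have [[lines27 _] _ points_rational [[E [Elines Eskew]]]] := hconj f hf hfull hsmooth.
move=> /(_ E (conj Elines Eskew)) [P [sixP [g [gbasis zl EE]]]].
have [a [b [B [ka [Vu Bu ka0 FE]]]]] :=
  rational_model char0 hf sixP gbasis zl EE Elines Eskew points_rational lines27.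
pose phi : {rmorphism rat -> Qp} := ratK char0.
have /choice [u uE] := fun x => padic_approx hQp x (frefl phi).
pose an r l := u (a l) r; pose bn r l := u (b l) r.
pose Bn r : 'M[rat]_4 := \matrix_(i, j) u (B i j) r.
have BE : mlim v phi Bn B.
  by move=> i j; under eq_fun do rewrite mxE; apply: uE.
have aE l : lim_to v phi (fun r => an r l) (a l) by apply: uE.
have bE l : lim_to v phi (fun r => bn r l) (b l) by apply: uE.
have FL := Fpoly_lim vP aE bE BE Vu Bu.
(* The exponents of degree less than 4 form a finite type, so one index serves
   all coefficients. *)
have coefE (m : bmultinom 4 4) : eventually_nat (fun r => mdeg m = 3 ->
    v (phi (mcoeff m (Fpoly (an r) (bn r) (Bn r)))) = v (ka * mcoeff m f)).
  have [m3|m3] := eqVneq (mdeg m) 3; last by exists 0%N => r _ /eqP; rewrite (negbTE m3).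
  have FLm := FL (bmnm m); rewrite FE mcoeffZ in FLm.
  have [|n0 H] := lim_val vP FLm; first by rewrite mulf_neq0 //; apply/eqP/hfull.
  by exists n0 => r /H.
have [n0 H] := eventually_and (eventually_fin coefE) (eventually_and
  (mlim_unit vP (veronese_lim vP aE bE) Vu) (mlim_unit vP BE Bu)).
have [{}coefE [Vn Bu_n]] := H n0 (leqnn n0).
have char0Q := pchar_num rat.
exists (affpt (an n0) (bn n0)), (gpoly (an n0) (bn n0) (Bn n0)); split.
- exact: six_points_affpt.
- exact: cubic_basis_gpoly.
exists (Fpoly (an n0) (bn n0) (Bn n0)); split; first exact: is_form_Fpoly.
  rewrite Fpoly_map; under eq_fun do rewrite gpoly_map.
  apply: surface_eq; [exact: pchar_num | | by rewrite map_unitmx].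
  by rewrite -veronese_map map_unitmx.
apply: (@trop_surface_shift _ _ _ (v ka)); first exact: val_fin.
move=> m m3; rewrite /coef_val -(padic_ratr hQp) -(valuationM vP).
have m4 : (mdeg m < 4)%N by rewrite m3.
by have := coefE (BMultinom m4) m3.
Qed.
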